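(* Let $S=\prod_{j=1}^dJ_j$, $J_j=[a_j,b_j]$, and let $I\subseteq[d]$ be nonempty. Suppose $\varphi(\omega)=\prod_{j=1}^dh_j(\omega_j)$ with $h_j\in L^\infty(J_j)$, and define $\bar h_j:=\frac1{b_j-a_j}\int_{J_j}h_j(t)\,dt$. Then $$\mathcal P_I\varphi=\left(\prod_{i\in I}(h_i-\bar h_i)\right)\left(\prod_{j\notin I}h_j\right)$$ (each factor $h_j$ being evaluated at $\omega_j$). In particular, if $\bar h_i=0$ for every $i\in I$, then $\mathcal P_I\varphi=\varphi$. Now let $f(\omega)=\prod_{j=1}^df_j(\omega_j)$, where every $f_j\in C^d(J_j)$ is a nonnegative probability density. Then $$\mathrm{TV}_I(f;S)=\sum_{i\in I}\int_{J_i}|f_i'(t)|\,dt,\qquad \int_S|\partial_If(\omega)|\,d\omega=\prod_{i\in I}\int_{J_i}|f_i'(t)|\,dt.$$ For $I=[d]$, $$V(f;S)=\prod_{i=1}^d\int_{J_i}|f_i'(t)|\,dt.$$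
   Context: $d\ge 1$, $[d]=\{1,\dots,d\}$, $a_j<b_j$. $(\Pi_i\varphi)(\omega)=\frac1{b_i-a_i}\int_{a_i}^{b_i}\varphi(\omega_{-i},t)\,dt$, where $\omega_{-i}=(\omega_j)_{j\neq i}$ and $t$ is inserted in coordinate $i$; these operators commute, and $\mathcal P_I=\prod_{i\in I}(\mathrm{Id}-\Pi_i)$. $D_if$ is the $i$th distributional derivative measure on the interior of $S$, $|D_if|(S)$ its total variation mass there, and $\mathrm{TV}_I(f;S)=\sum_{i\in I}|D_if|(S)$. For $I=\{i_1<\cdots<i_k\}$, $\partial_If=\partial_{i_1}\cdots\partial_{i_k}f$. Vitali variation: $V(f;S)=\sup_{\mathcal Q}\sum_{S_j\in\mathcal Q}|\sigma(f,S_j)|$ over finite families $\mathcal Q$ of axis-parallel closed boxes $S_j=\prod_\ell[a^j_\ell,b^j_\ell]$ with pairwise disjoint interiors and union $S$, where $\sigma(f,S_j)=\sum_{\nu\in\{0,1\}^d}(-1)^{\nu_1+\cdots+\nu_d}f(b^j+\nu\odot(a^j-b^j))$ and $\odot$ is the componentwise product. *)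

(* Defs.v *)
From HB Require Import structures.
From mathcomp Require Import all_boot all_order all_algebra.
From mathcomp Require Import all_classical all_reals all_analysis.

Set Implicit Arguments.
Unset Strict Implicit.
Unset Printing Implicit Defensive.

Import Order.TTheory GRing.Theory Num.Theory.
Import numFieldNormedType.Exports.

Local Open Scope classical_set_scope.
Local Open Scope ring_scope.

(** Lebesgue measure on ['rV[R]_d]: the sigma-algebra is generated by the
    coordinate projections, as for [n.-tuple T] in [measurable_structure]. *)

Definition rV_display : measure_display. Proof. exact: default_measure_display. Qed.

Section measurable_rV.
Context {R : realType} (n : nat).

Let coord : 'I_n -> 'rV[R]_n -> measurableTypeR R := fun i w => w 0 i.

HB.instance Definition _ := @isMeasurable.Build rV_display 'rV[R]_n
  (g_sigma_preimage coord) (@sigma_algebra0 _ _ _) (@sigma_algebraC _ _)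
  (@sigma_algebra_bigcup _ _ _).

Lemma measurable_coord (i : 'I_n) :
  measurable_fun setT (fun w : 'rV[R]_n => w 0 i : measurableTypeR R).
Proof.
move=> _ Y mY; rewrite setTI; apply: sub_sigma_algebra => /=.
rewrite -bigcup_seq/=; exists i => /=; first by rewrite mem_index_enum.
by exists Y => //; rewrite setTI.
Qed.

Lemma measurable_fun_rV d (T : measurableType d) (f : T -> 'rV[R]_n) :
  (forall i, measurable_fun setT (fun t => f t 0 i : measurableTypeR R)) ->
  measurable_fun setT f.
Proof.
move=> mf _ Y mY; rewrite setTI; move: Y mY.
suff : g_sigma_preimage (fun i => coord i \o f) `<=` measurable.
  rewrite g_sigma_preimage_comp => h Y mY; apply: h.
  by exists Y => //; rewrite setTI.
apply: smallest_sub; first exact: sigma_algebra_measurable.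
rewrite -bigcup_seq => A [i _ [B mB <-]]; exact: mf.
Qed.

End measurable_rV.

Section lebesgue_rV.
Context {R : realType}.

Definition rV_cons n (p : measurableTypeR R * 'rV[R]_n) : 'rV[R]_n.+1 :=
  \row_i oapp (p.2 0) p.1 (unlift ord0 i).

Lemma rV_cons0 n (p : measurableTypeR R * 'rV[R]_n) : rV_cons p 0 ord0 = p.1.
Proof.
by rewrite mxE unlift_none.
Qed.

Lemma rV_consS n (p : measurableTypeR R * 'rV[R]_n) (j : 'I_n) :
  rV_cons p 0 (lift ord0 j) = p.2 0 j.
Proof.
by rewrite mxE liftK.
Qed.

Definition rV_uncons n (w : 'rV[R]_n.+1) : measurableTypeR R * 'rV[R]_n :=
  (w 0 ord0, \row_j w 0 (lift ord0 j)).

Lemma rV_consK n : cancel (@rV_cons n) (@rV_uncons n).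
Proof.
move=> [x v]; rewrite /rV_uncons rV_cons0; congr pair.
by apply/rowP => j; rewrite mxE rV_consS.
Qed.

Lemma measurable_rV_cons n : measurable_fun setT (@rV_cons n).
Proof.
apply: measurable_fun_rV => i; case: (unliftP ord0 i) => [j ->|->].
  under eq_fun do rewrite rV_consS.
  apply: (@measurableT_comp _ _ _ _ _ _
    (fun w : 'rV[R]_n => w 0 j : measurableTypeR R)) => //.
  exact: measurable_coord.
under eq_fun do rewrite rV_cons0.
exact: measurable_fst.
Qed.

Lemma measurable_rV_uncons n : measurable_fun setT (@rV_uncons n).
Proof.
apply/measurable_fun_pairP; split; first exact: measurable_coord.
apply: measurable_fun_rV => i /=.
under eq_fun do rewrite mxE.
exact: measurable_coord.
Qed.

Section step.
Variables (n : nat) (mu : {sigma_finite_measure set 'rV[R]_n -> \bar R}).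

Definition lebesgue_rV_step : set 'rV[R]_n.+1 -> \bar R :=
  pushforward (lebesgue_measure \x mu)%E (@rV_cons n).

Let step0 : lebesgue_rV_step set0 = 0%E.
Proof. by rewrite /lebesgue_rV_step /pushforward preimage_set0 measure0. Qed.

Let step_ge0 A : (0 <= lebesgue_rV_step A)%E.
Proof. by rewrite /lebesgue_rV_step /pushforward measure_ge0. Qed.

Let step_sigma_additive : semi_sigma_additive lebesgue_rV_step.
Proof.
have mf A : measurable A -> measurable (@rV_cons n @^-1` A).
  by move=> mA; rewrite -[X in measurable X]setTI; exact: measurable_rV_cons.
move=> F mF tF mUF; rewrite /lebesgue_rV_step /pushforward preimage_bigcup.
apply: measure_semi_sigma_additive => [k||]; first exact: mf.
- apply/trivIsetP => i j _ _ ij; rewrite -preimage_setI.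
  by move/trivIsetP : tF => -> //; rewrite preimage_set0.
- by rewrite -preimage_bigcup; exact: mf.
Qed.

HB.instance Definition _ := isMeasure.Build _ _ _ lebesgue_rV_step
  step0 step_ge0 step_sigma_additive.

Let step_sigma_finite : sigma_finite setT lebesgue_rV_step.
Proof.
have /sigma_finiteP[F [UF ndF mF]] := sigma_finiteT (@lebesgue_measure R).
have /sigma_finiteP[G [UG ndG mG]] := sigma_finiteT mu.
exists (fun k => @rV_uncons n @^-1` (F k `*` G k)) => [|k].
  apply/esym/seteqP; split => // w _ /=.
  have [i _ Fi] : (\bigcup_k F k) (w 0 ord0) by rewrite -UF.
  have [j _ Gj] : (\bigcup_k G k) (rV_uncons w).2 by rewrite -UG.
  exists (maxn i j) => //; split => /=.
    by move: Fi; exact/subsetPset/ndF/leq_maxl.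
  by move: Gj; exact/subsetPset/ndG/leq_maxr.
have [mFk Fk_fin] := mF k; have [mGk Gk_fin] := mG k; split.
  rewrite -[X in measurable X]setTI; apply: measurable_rV_uncons => //.
  exact: measurableX.
rewrite /lebesgue_rV_step /pushforward -comp_preimage.
rewrite (_ : _ \o _ = id) ?preimage_id; last exact/funext/rV_consK.
by rewrite product_measure1E// lte_mul_pinfty// ge0_fin_numE.
Qed.

HB.instance Definition _ := Measure_isSigmaFinite.Build _ _ _ lebesgue_rV_step
  step_sigma_finite.

End step.

Fixpoint lebesgue_rV n : {sigma_finite_measure set 'rV[R]_n -> \bar R} :=
  match n with
  | 0 => \d_(0 : 'rV[R]_0)
  | n'.+1 => lebesgue_rV_step (lebesgue_rV n')
  end.

End lebesgue_rV.
Arguments lebesgue_rV {R}.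

Definition box (R : realType) d (a b : 'rV[R]_d) : set 'rV[R]_d :=
  [set w | forall i, w 0 i \in `[a 0 i, b 0 i]].

Lemma lebesgue_rV_box (R : realType) d (a b : 'rV[R]_d) :
  (forall i, a 0 i <= b 0 i) ->
  lebesgue_rV d (box a b) = (\prod_i (b 0 i - a 0 i))%:E.
Proof.
elim: d a b => [|d IH] a b ab.
  rewrite big_ord0 /= (_ : box a b = setT) ?diracT//.
  by apply/seteqP; split => // w _ [].
pose tl (c : 'rV[R]_d.+1) : 'rV[R]_d := \row_j c 0 (lift ord0 j).
have boxE : @rV_cons R d @^-1` box a b =
    `[a 0 ord0, b 0 ord0] `*` box (tl a) (tl b).
  apply/seteqP; split => [p pab|p [p1 p2] i] /=.
    split; first by have := pab ord0; rewrite rV_cons0.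
    by move=> j; have := pab (lift ord0 j); rewrite rV_consS !mxE.
  case: (unliftP ord0 i) => [j|] ->; last by rewrite rV_cons0.
  by rewrite rV_consS; have := p2 j; rewrite !mxE.
have mbox (c e : 'rV[R]_d) : measurable (box c e).
  rewrite (_ : box c e = \bigcap_(i in [set: 'I_d])
      ((fun w : 'rV[R]_d => w 0 i : measurableTypeR R) @^-1` `[c 0 i, e 0 i])).
    apply: fin_bigcap_measurable => // i _.
    rewrite -[X in measurable X]setTI.
    by apply: measurable_coord => //; exact: measurable_itv.
  by apply/seteqP; split => [w h i _|w h i]; exact: h.
rewrite /= /lebesgue_rV_step /pushforward boxE product_measure1E//.
rewrite IH => [|i]; last by rewrite !mxE.
rewrite big_ord_recl EFinM; congr (_ * _)%E; last first.
  by congr EFin; apply: eq_bigr => i _; rewrite !mxE.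
transitivity (lebesgue_measure `[a 0 ord0, b 0 ord0]) => //.
rewrite lebesgue_measure_itv/= lte_fin.
have [//|ba] := ltP.
by rewrite (@le_anti _ _ (a 0 ord0) (b 0 ord0)) ?subrr ?ab.
Qed.

Section product_domain.
Context {R : realType} {d : nat}.
Implicit Types (a b w : 'rV[R]_d) (i : 'I_d) (I : {set 'I_d}).

Definition side a b i : set R := `[a 0 i, b 0 i].

Definition upd w i (t : R) : 'rV[R]_d := \row_j if j == i then t else w 0 j.

(** [L^oo(D)]: extension by zero lies in the [L^oo] space of the ambient
    measure. *)
Definition Linfty_on disp (T : measurableType disp)
    (mu : {measure set T -> \bar R}) (D : set T) (f : T -> R) :=
  f \_ D \in Lfun mu +oo%E.

Definition mean a b i (h : R -> R) : R :=
  (b 0 i - a 0 i)^-1 * \int[lebesgue_measure]_(t in side a b i) h t.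

Definition Pi_op a b i (phi : 'rV[R]_d -> R) : 'rV[R]_d -> R :=
  fun w => mean a b i (fun t => phi (upd w i t)).

(** Composition of the [Id - Pi_i] for [i] in [I], in increasing order. *)
Definition P_op a b I : ('rV[R]_d -> R) -> 'rV[R]_d -> R :=
  \big[comp/id]_(i in I) (fun phi => phi \- Pi_op a b i phi).

(** Derivative relative to [A]; one-sided at the endpoints of an interval. *)
Definition derive_in (A : set R) (g : R -> R) (x : R) : R :=
  lim ((y - x)^-1 * (g y - g x) @[y --> within A x^']).

Definition derivable_in (A : set R) (g : R -> R) (x : R) : Prop :=
  cvg ((y - x)^-1 * (g y - g x) @[y --> within A x^']).

Fixpoint Ck_on (A : set R) (k : nat) (g : R -> R) : Prop :=
  {within A, continuous g} /\
  if k is k'.+1 then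
    (forall x, A x -> derivable_in A g x) /\ Ck_on A k' (derive_in A g)
  else True.

Definition partial_in a b i (f : 'rV[R]_d -> R) : 'rV[R]_d -> R :=
  fun w => derive_in (side a b i) (fun t => f (upd w i t)) (w 0 i).

(** [partial_in i_1 \o ... \o partial_in i_k] for [I = {i_1 < ... < i_k}]. *)
Definition partials_in a b I : ('rV[R]_d -> R) -> 'rV[R]_d -> R :=
  \big[comp/id]_(i in I) partial_in a b i.

Definition partial i (psi : 'rV[R]_d -> R) : 'rV[R]_d -> R :=
  fun w => 'D_(delta_mx 0 i) psi w.

Definition smooth (psi : 'rV[R]_d -> R) : Prop :=
  forall s : seq 'I_d, let g := foldr partial psi s in
    continuous g /\ forall i w, derivable g w (delta_mx 0 i).

(** [C_c^oo(U)] *)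
Definition test_function (U : set 'rV[R]_d) (psi : 'rV[R]_d -> R) : Prop :=
  let supp := closure [set w | psi w != 0] in
  [/\ smooth psi, compact supp & supp `<=` U].

(** [nu] is the distributional derivative [D_i f] on the open set [U].  Charges
    are finite; the integral against [nu] is taken through its Jordan
    decomposition.  Only the restriction of [nu] to [U] matters. *)
Definition is_distr_derive (U : set 'rV[R]_d) i (f : 'rV[R]_d -> R)
    (nu : {charge set 'rV[R]_d -> \bar R}) P N
    (nuPN : hahn_decomposition nu P N) : Prop :=
  (forall K, compact K -> K `<=` U ->
    (lebesgue_rV d).-integrable K (EFin \o f)) /\
  forall psi, test_function U psi ->
    \int[lebesgue_rV d]_(w in U) (f w * partial i psi w) =
    - (\int[jordan_pos nuPN]_(w in U) psi w -
       \int[jordan_neg nuPN]_(w in U) psi w).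

(** [|D_i f|(S)], the total variation mass of [D_i f] on the interior of [S];
    [+oo] if [D_i f] is not a finite signed measure there.  The measure is
    unique on [S^o], hence so is the element picked by [xget]. *)
Definition distr_variation (S : set 'rV[R]_d) i (f : 'rV[R]_d -> R) : \bar R :=
  xget +oo%E [set x | exists (nu : {charge set 'rV[R]_d -> \bar R}) P N
    (nuPN : hahn_decomposition nu P N),
    is_distr_derive S° i f nuPN /\ x = charge_variation nuPN S°].

Definition TV I (f : 'rV[R]_d -> R) (S : set 'rV[R]_d) : \bar R :=
  (\sum_(i in I) distr_variation S i f)%E.

Definition box_increment (f : 'rV[R]_d -> R) a b : R :=
  \sum_(nu : {ffun 'I_d -> bool})
    (-1) ^+ (\sum_l nu l)%N * f (\row_l (b 0 l + (nu l)%:R * (a 0 l - b 0 l))).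

(** Partitions of [S] into nondegenerate closed boxes [box (lo j) (hi j)]. *)
Definition box_partition (S : set 'rV[R]_d) m (lo hi : 'I_m -> 'rV[R]_d) :=
  [/\ forall j l, lo j 0 l < hi j 0 l,
      trivIset setT (fun j => (box (lo j) (hi j))°) &
      \bigcup_j box (lo j) (hi j) = S].

Definition vitali_variation (f : 'rV[R]_d -> R) (S : set 'rV[R]_d) : \bar R :=
  ereal_sup [set x | exists m (lo hi : 'I_m -> 'rV[R]_d),
    box_partition S lo hi /\
    x = (\sum_(j < m) `|box_increment f (lo j) (hi j)|)%:E].

Definition prob_density (A : set R) (g : R -> R) : Prop :=
  (forall t, A t -> 0 <= g t) /\
  (\int[lebesgue_measure]_(t in A) (g t)%:E = 1)%E.

End product_domain.

(* Main.v *)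
Require Import Defs.
From HB Require Import structures.
From mathcomp Require Import all_boot all_order all_algebra.
From mathcomp Require Import all_classical all_reals all_analysis.
From mathcomp Require Import measurable_realfun ring lra.
Import Order.TTheory GRing.Theory Num.Theory.
Import numFieldNormedType.Exports.
Local Open Scope classical_set_scope.
Local Open Scope ring_scope.

Set Implicit Arguments.
Unset Strict Implicit.
Unset Printing Implicit Defensive.

(** All four assertions come from the same fact: on a tensor product
    [phi w = \prod_j h_j (w_j)], an operation on the [i]-th coordinate acts on
    the [i]-th factor alone.

    For [P_op], the operator [Id - Pi_i] replaces the factor [h_i] by
    [h_i - mean h_i]; an induction over the elements of [I] ([P_seq_prod]) gives
    the formula.  As [phi] is a tensor product only almost everywhere, the
    exceptional set has to be followed through the induction: by Tonelli in
    the [i]-th coordinate, almost every line parallel to the [i]-th axis meets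
    a null set in a null set ([ae_upd]).  Lebesgue measure on ['rV] is
    defined by peeling off the first coordinate, so its invariance under the
    choice of the coordinate that is split off is established beforehand
    ([lebesgue_rV_ins]).

    The mixed derivative [partials_in a b I f] is again a tensor product, so
    its [L^1] norm is a product of one-dimensional integrals; the factors
    outside [I] are densities and contribute [1] ([integral_partials_in]).

    For the Vitali variation, the increment of [f] over a box is the product
    of the increments of its factors, each of which is at most the integral of
    [|f_l'|] over the corresponding edge.  Hence the sum over a partition is at most
    the integral of [\prod_l |f_l'(w_l)|] over [S].  Conversely, the sum
    over a uniform grid factors into one-dimensional sums of absolute
    increments, and these tend to the integrals of [|f_l'|] because [f_l'] is
    uniformly continuous ([grid_variation_cvg]).

    For the total variation, let [rho] be the product of [f_i'(w_i)] and of the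
    [f_j(w_j)] for [j != i].  Integration by parts on lines ([by_parts])
    shows that [rho] is the density of [D_i f] on the interior of [S], so the
    variation is the [L^1] norm of [rho], that is the integral of [|f_i'|].  The
    variation is defined through an arbitrary charge that represents [D_i f],
    whence the need for uniqueness ([density_of_distr_derive]): the indicator
    of an open box is the pointwise limit of the test functions
    [1 - (1 - beta_k)^k], where the smooth bumps [beta_k], built from
    [exp (-1/x)], have supports that increase to the box; so two such charges agree on open boxes, hence everywhere by
    Dynkin's lemma. *)

(** * Integration in coordinates on row vectors *)

(** [nu] is only required to agree with the image of [mu] on measurable sets:
    Lebesgue measure on ['rV] is not by definition the image measure for an
    insertion in an arbitrary coordinate. *)
Section image_measure.
Context d1 d2 (X : measurableType d1) (Y : measurableType d2) (R : realType).
Variables (phi : X -> Y) (mphi : measurable_fun setT phi).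
Variables (mu : {measure set X -> \bar R}) (nu : {measure set Y -> \bar R}).
Hypothesis nuE : forall A, measurable A -> nu A = mu (phi @^-1` A).
Lemma ge0_integral_image_measure (f : Y -> \bar R) : measurable_fun setT f ->
  (forall y, 0 <= f y)%E -> (\int[nu]_y f y = \int[mu]_x f (phi x))%E.
Proof.
move=> mf f0; have := @ge0_integral_pushforward _ _ _ _ R _ mphi mu setT f measurableT mf.
rewrite preimage_setT => <- //.
by apply: eq_measure_integral => A mA _; rewrite nuE.
Qed.

Lemma integrable_image_measure (f : Y -> \bar R) : nu.-integrable setT f ->
  mu.-integrable setT (f \o phi).
Proof.
move=> /integrableP[mf foo]; apply/integrableP; split; first exact: measurableT_comp.
have maf : measurable_fun setT (abse \o f) by exact: measurableT_comp.
have := ge0_integral_image_measure maf (fun y => abse_ge0 (f y)).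
by move=> /= <-.
Qed.

Lemma integral_image_measure (f : Y -> \bar R) : nu.-integrable setT f ->
  (\int[nu]_y f y = \int[mu]_x f (phi x))%E.
Proof.
move=> intf; have mf := measurable_int _ intf.
have := @integral_pushforward _ _ _ _ R _ mphi mu setT f mf
  (integrable_image_measure intf) measurableT.
rewrite preimage_setT => <-.
by apply: eq_measure_integral => A mA _; rewrite nuE.
Qed.

End image_measure.

Section rect.
Context {R : realType}.

Definition rect n (A : 'I_n -> set R) : set 'rV[R]_n :=
  [set w | forall i, A i (w 0 i)].

Lemma measurable_rect n (A : 'I_n -> set R) :
  (forall i, measurable (A i)) -> measurable (rect A).
Proof.
move=> mA; rewrite (_ : rect A = \bigcap_(i in [set: 'I_n])
    ((fun w : 'rV[R]_n => w 0 i : measurableTypeR R) @^-1` A i)).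
  apply: fin_bigcap_measurable => // i _.
  by rewrite -[X in measurable X]setTI; apply: measurable_coord => //; exact: mA.
by apply/seteqP; split => [w h i _|w h i]; exact: h.
Qed.

Lemma measurable_comp_coord n i d (T : measurableType d) (g : R -> T) :
  measurable_fun setT g -> measurable_fun setT (fun w : 'rV[R]_n => g (w 0 i)).
Proof.
move=> mg.
apply: (@measurableT_comp _ _ _ _ _ _ g _ (fun w : 'rV[R]_n => w 0 i : measurableTypeR R)) => //.
exact: measurable_coord.
Qed.

Lemma prod_ge0_ereal (J : Type) (r : seq J) (P : pred J) (F : J -> \bar R) :
  (forall j, P j -> 0 <= F j)%E -> (0 <= \prod_(j <- r | P j) F j)%E.
Proof.
by move=> F0; elim/big_ind : _ => // x y x0 y0; exact: mule_ge0.
Qed.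

Lemma emeasurable_prod d (T : measurableType d) (J : Type) (r : seq J)
    (P : pred J) (F : J -> T -> \bar R) D :
  (forall j, P j -> measurable_fun D (F j)) ->
  measurable_fun D (fun x => \prod_(j <- r | P j) F j x)%E.
Proof.
move=> mF; elim: r => [|j r IH].
  by under eq_fun do rewrite big_nil; exact: measurable_cst.
under eq_fun do rewrite big_cons.
have [Pj|nPj] := boolP (P j) => //; apply: emeasurable_funM => //; exact: mF.
Qed.

Lemma ge0_integral_lebesgue_rVS n (f : 'rV[R]_n.+1 -> \bar R) :
  measurable_fun setT f -> (forall w, 0 <= f w)%E ->
  (\int[lebesgue_rV n.+1]_w f w =
   \int[lebesgue_measure \x lebesgue_rV n]_p f (rV_cons p))%E.
Proof.
move=> mf f0; have mcons := @measurable_rV_cons R n.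
have := @ge0_integral_pushforward _ _ _ _ R _ mcons
  (lebesgue_measure \x lebesgue_rV n)%E setT f measurableT mf.
by rewrite preimage_setT => <-.
Qed.

(** Peel off the first coordinate, along which [lebesgue_rV] is defined, and
    apply Tonelli. *)
Lemma integral_prod_coord n (g : 'I_n -> R -> \bar R) :
  (forall i, measurable_fun setT (g i)) -> (forall i x, 0 <= g i x)%E ->
  (\int[lebesgue_rV n]_w \prod_i g i (w 0%R i) =
   \prod_i \int[lebesgue_measure]_x g i x)%E.
Proof.
elim: n g => [|n IH] g mg g0.
  rewrite big_ord0 /=.
  under eq_integral do rewrite big_ord0.
  by rewrite integral_cst// mul1e /= diracT.
rewrite ge0_integral_lebesgue_rVS//=; last 2 first.
- by apply: emeasurable_prod => i _; exact: measurable_comp_coord.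
- by move=> w; exact: prod_ge0_ereal.
rewrite fubini_tonelli1//=; last 2 first.
- under eq_fun do rewrite /=.
  apply: emeasurable_prod => i _.
  have : measurable_fun setT (fun w : 'rV[R]_n.+1 => g i (w 0%R i)).
    exact: measurable_comp_coord.
  move=> /measurableT_comp; apply; exact: measurable_rV_cons.
- by move=> p; exact: prod_ge0_ereal.
rewrite /fubini_F big_ord_recl -ge0_integralZr//; last 2 first.
- exact: mg.
- by apply: prod_ge0_ereal => j _; exact: integral_ge0.
apply: eq_integral => x _ /=.
rewrite -IH// -ge0_integralZl//; last 2 first.
- by apply: emeasurable_prod => i _; exact: measurable_comp_coord.
- by move=> w _; exact: prod_ge0_ereal.
apply: eq_integral => w _; rewrite big_ord_recl rV_cons0.
by congr (_ * _)%E; apply: eq_bigr => i _; rewrite rV_consS.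
Qed.

Lemma integral_prod_rect n (A : 'I_n -> set R) (g : 'I_n -> R -> \bar R) :
  (forall i, measurable (A i)) ->
  (forall i, measurable_fun (A i) (g i)) ->
  (forall i x, A i x -> 0 <= g i x)%E ->
  (\int[lebesgue_rV n]_(w in rect A) \prod_i g i (w 0%R i) =
   \prod_i \int[lebesgue_measure]_(x in A i) g i x)%E.
Proof.
move=> mA mg g0.
transitivity (\int[lebesgue_rV n]_w \prod_i (g i \_ (A i)) (w 0%R i))%E.
  rewrite integral_mkcond; apply: eq_integral => w _; rewrite patchE.
  case: ifPn => [/set_mem wA|/negP wA].
    by apply: eq_bigr => i _; rewrite patchE mem_set//; exact: wA.
  have /existsNP[i Ai] : ~ rect A w by move=> ?; apply: wA; rewrite inE.
  by rewrite (bigD1 i)//= patchE memNset// mul0e.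
rewrite (integral_prod_coord (g := fun i => g i \_ (A i)))//.
- by apply: eq_bigr => i _; rewrite -integral_mkcond.
- by move=> i; apply/(measurable_restrictT _ _).1.
- by move=> i x; rewrite patchE; case: ifPn => // /set_mem; exact: g0.
Qed.

Lemma lebesgue_rV_rect n (A : 'I_n -> set R) : (forall i, measurable (A i)) ->
  (lebesgue_rV n (rect A) = \prod_i lebesgue_measure (A i))%E.
Proof.
move=> mA; have := @integral_prod_rect n A (fun _ _ => 1%E) mA.
under eq_integral do rewrite big1_eq.
rewrite integral_cst ?mul1e//; last exact: measurable_rect.
move=> ->//; apply: eq_bigr => i _.
by rewrite integral_cst ?mul1e//; exact: mA.
Qed.

End rect.

Section ins.
Context {R : realType}.

(** [rV_cons] inserts the new entry in front; slicing along the [i]-th axis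
    requires to insert it at position [i]. *)
Definition rV_ins n (i : 'I_n.+1) (p : measurableTypeR R * 'rV[R]_n) :
    'rV[R]_n.+1 := \row_j oapp (p.2 0) p.1 (unlift i j).

Lemma rV_insE n (i : 'I_n.+1) p : @rV_ins n i p 0 i = p.1.
Proof. by rewrite mxE unlift_none. Qed.

Lemma rV_ins_lift n (i : 'I_n.+1) p j : @rV_ins n i p 0 (lift i j) = p.2 0 j.
Proof. by rewrite mxE liftK. Qed.

Lemma measurable_rV_ins n (i : 'I_n.+1) : measurable_fun setT (@rV_ins n i).
Proof.
apply: measurable_fun_rV => k; case: (unliftP i k) => [j ->|->].
  under eq_fun do rewrite rV_ins_lift.
  by apply: (@measurableT_comp _ _ _ _ _ _
    (fun w : 'rV[R]_n => w 0 j : measurableTypeR R)) => //; exact: measurable_coord.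
by under eq_fun do rewrite rV_insE; exact: measurable_fst.
Qed.

Lemma preimage_rV_ins_rect n (i : 'I_n.+1) (A : 'I_n.+1 -> set R) :
  rV_ins i @^-1` rect A = A i `*` rect (fun j => A (lift i j)).
Proof.
apply/seteqP; split => [p Ap|p [p1 p2] k] /=.
  split; first by have := Ap i; rewrite rV_insE.
  by move=> j; have := Ap (lift i j); rewrite rV_ins_lift.
case: (unliftP i k) => [j|] ->; last by rewrite rV_insE.
by rewrite rV_ins_lift; exact: p2.
Qed.

Lemma measurable_rVE n : @measurable _ 'rV[R]_n =
  <<s [set rect A | A in [set A : 'I_n -> set R | forall i, measurable (A i)]] >>.
Proof.
apply/seteqP; split.
  apply: smallest_sub; first exact: smallest_sigma_algebra.
  rewrite -bigcup_seq => A [i _ [B mB <-]].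
  apply: sub_sigma_algebra; exists (fun j => if j == i then B else setT).
    by move=> j; case: ifP.
  rewrite setTI; apply/seteqP; split => w /=.
    by move=> /(_ i); rewrite eqxx.
  by move=> Bw j; case: ifP => // /eqP ->.
apply: smallest_sub; first exact: sigma_algebra_measurable.
by move=> _ [A mA <-]; exact: measurable_rect.
Qed.

(** Both sides are measures of the same rectangles, which are stable under
    intersection and generate the sigma-algebra. *)
Lemma lebesgue_rV_ins n (i : 'I_n.+1) B : measurable B ->
  lebesgue_rV n.+1 B = (lebesgue_measure \x lebesgue_rV n)%E (@rV_ins n i @^-1` B).
Proof.
have mins := @measurable_rV_ins n i.
pose m2 : {measure set 'rV[R]_n.+1 -> \bar R} :=
  measure_function_pushforward__canonical__measure_function_Measure
    (lebesgue_measure \x lebesgue_rV n)%E mins.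
rewrite -[RHS]/(m2 B).
apply: (@measure_unique _ _ _ _ (fun k => rect (fun=> `[- k%:R, k%:R]%classic))
   (@measurable_rVE n.+1)).
- move=> _ _ [A mA <-] [C mC <-]; exists (fun j => A j `&` C j).
    by move=> j; exact: measurableI.
  apply/seteqP; split => w /=; first by move=> h; split => j; have [] := h j.
  by move=> [h1 h2] j.
- by move=> k; exists (fun=> `[- k%:R, k%:R]%classic).
- apply/seteqP; split => // w _.
  pose k := (\max_(j < n.+1) Num.truncn `|w 0%R j|).+1.
  exists k => // j /=; rewrite in_itv/= -ler_norml.
  apply: (@le_trans _ _ (Num.truncn `|w 0 j|).+1%:R).
    by apply/ltW; exact: truncnS_gt.
  by rewrite ler_nat ltnS; exact: (leq_bigmax j).
- move=> _ [A mA <-].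
  rewrite /m2/= /pushforward preimage_rV_ins_rect product_measure1E//; last 2 first.
  + exact: mA.
  + by apply: measurable_rect => j; exact: mA.
  rewrite -[LHS]/(lebesgue_rV n.+1 (rect A)).
  by rewrite !lebesgue_rV_rect// (bigD1_ord i).
- move=> k; have := @lebesgue_rV_box R n.+1 (const_mx (- k%:R)) (const_mx k%:R).
  rewrite (_ : box _ _ = rect (fun=> `[- k%:R, k%:R]%classic)); last first.
    by apply/seteqP; split => w h j; have := h j; rewrite /= !mxE.
  move=> h; have kk (j : 'I_n.+1) :
      (const_mx (- k%:R) : 'rV[R]_n.+1) 0 j <= (const_mx k%:R : 'rV[R]_n.+1) 0 j.
    by rewrite !mxE ge0_cp.
  by have := ltry (\prod_j ((const_mx k%:R : 'rV[R]_n.+1) 0 j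
    - (const_mx (- k%:R) : 'rV[R]_n.+1) 0 j)); rewrite -(h kk).
Qed.

Lemma ge0_integral_lebesgue_rV_ins n (i : 'I_n.+1) (f : 'rV[R]_n.+1 -> \bar R) :
  measurable_fun setT f -> (forall w, 0 <= f w)%E ->
  (\int[lebesgue_rV n.+1]_w f w =
   \int[lebesgue_measure \x lebesgue_rV n]_p f (rV_ins i p))%E.
Proof.
by move=> mf f0; apply: ge0_integral_image_measure => //;
  [exact: measurable_rV_ins|exact: lebesgue_rV_ins].
Qed.

Lemma integral_lebesgue_rV_ins n (i : 'I_n.+1) (f : 'rV[R]_n.+1 -> \bar R) :
  (lebesgue_rV n.+1).-integrable setT f ->
  (\int[lebesgue_rV n.+1]_w f w =
   \int[lebesgue_rV n]_v \int[lebesgue_measure]_x f (rV_ins i (x, v)))%E.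
Proof.
move=> intf.
have [mins muE] := (@measurable_rV_ins n i, @lebesgue_rV_ins n i).
rewrite (integral_image_measure mins muE intf).
by rewrite -(integral21_prod_meas1 (integrable_image_measure mins muE intf)).
Qed.

Lemma upd_rV_ins n (i : 'I_n.+1) x v t : upd (rV_ins i (x, v)) i t = rV_ins i (t, v).
Proof.
apply/rowP => j; rewrite mxE; case: (unliftP i j) => [k|] ->.
  by rewrite eq_sym (negbTE (neq_lift _ _)) !rV_ins_lift.
by rewrite eqxx rV_insE.
Qed.

Definition rV_del n (i : 'I_n.+1) (w : 'rV[R]_n.+1) : 'rV[R]_n :=
  \row_j w 0 (lift i j).

Lemma rV_delK n (i : 'I_n.+1) (w : 'rV[R]_n.+1) : rV_ins i (w 0 i, rV_del i w) = w.
Proof.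
by apply/rowP => j; case: (unliftP i j) => [k|] ->; rewrite ?rV_insE ?rV_ins_lift ?mxE.
Qed.

Lemma rV_insK n (i : 'I_n.+1) p : rV_del i (rV_ins i p) = p.2.
Proof. by apply/rowP => j; rewrite mxE rV_ins_lift. Qed.

Lemma measurable_rV_del n (i : 'I_n.+1) : measurable_fun setT (@rV_del n i).
Proof.
apply: measurable_fun_rV => j; under eq_fun do rewrite mxE.
exact: measurable_coord.
Qed.

Lemma upd_rV_del n (i : 'I_n.+1) w t : upd w i t = rV_ins i (t, rV_del i w).
Proof. by rewrite -[in LHS](rV_delK i w) upd_rV_ins. Qed.

Lemma ae_rV_del n (i : 'I_n.+1) (P : 'rV[R]_n -> Prop) :
  {ae lebesgue_rV n, forall v, P v} ->
  {ae lebesgue_rV n.+1, forall w, P (rV_del i w)}.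
Proof.
move=> [M [mM M0 PM]]; exists (rV_del i @^-1` M); split.
- by rewrite -[X in measurable X]setTI; exact: measurable_rV_del.
- have mB : measurable (rV_del i @^-1` M).
    by rewrite -[X in measurable X]setTI; exact: measurable_rV_del.
  rewrite (lebesgue_rV_ins i mB) (_ : _ @^-1` _ = setT `*` M).
    by rewrite product_measure1E//; apply/eqP; rewrite mule_eq0; apply/orP; right; apply/eqP.
  by apply/seteqP; split => [p|p [_]] /=; rewrite rV_insK.
- by move=> w Pw; apply: PM.
Qed.

(** The slices of a null set along the [i]-th axis have lengths that integrate
    to [0] by Tonelli, so almost all of them are null. *)
Lemma ae_upd n (i : 'I_n.+1) (P : 'rV[R]_n.+1 -> Prop) :
  {ae lebesgue_rV n.+1, forall w, P w} ->
  {ae lebesgue_rV n.+1, forall w, {ae lebesgue_measure, forall t, P (upd w i t)}}.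
Proof.
move=> [N [mN N0 PN]]; have mins := @measurable_rV_ins n i.
pose F v : \bar R := (\int[lebesgue_measure]_t (\1_N (rV_ins i (t, v)))%:E)%E.
have mf : measurable_fun setT (fun w : 'rV[R]_n.+1 => (\1_N w : R)%:E).
  by apply/measurable_EFinP; exact: measurable_indic.
have mg : measurable_fun setT (fun p => (\1_N (rV_ins i p) : R)%:E).
  exact: (measurableT_comp mf mins).
have F0 : (\int[lebesgue_rV n]_v F v = 0)%E.
  rewrite /F -(fubini_tonelli2 (fun p => (\1_N (rV_ins i p) : R)%:E)) => //.
  rewrite -(ge0_integral_lebesgue_rV_ins i mf)// integral_indic// setIT.
  exact: N0.
have mF : measurable_fun setT F.
  exact: (measurable_fun_fubini_tonelli_G (fun p => (\1_N (rV_ins i p) : R)%:E)).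
have Fge0 v : (0 <= F v)%E by exact: integral_ge0.
have aeF : {ae lebesgue_rV n, forall v, F v = 0%E}.
  have := (ae_eq_integral_abs (lebesgue_rV n) measurableT mF).1.
  rewrite (eq_integral F) => [/(_ F0)|v _]; last by rewrite gee0_abs.
  by apply: filterS => v /(_ I).
have := ae_rV_del i aeF; apply: filterS => w Fw.
have mNw : measurable [set t | N (upd w i t)].
  rewrite (_ : [set t | _] = ysection (rV_ins i @^-1` N) (rV_del i w)).
    by apply: measurable_ysection; rewrite -[X in measurable X]setTI; exact: mins.
  by apply/seteqP; split => t; rewrite /ysection/= inE /= upd_rV_del.
exists [set t | N (upd w i t)]; split => //.
  rewrite -Fw /F -[LHS](_ : \int[lebesgue_measure]_t (\1_[set t | N (upd w i t)] t)%:E = _)%E.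
    apply: eq_integral => t _; congr EFin.
    rewrite !indicE; congr (_%:R); congr nat_of_bool.
    by apply/idP/idP; rewrite !inE /= upd_rV_del.
  by rewrite integral_indic// setIT.
by move=> t Pt; apply: PN.
Qed.

End ins.

(** * Borel sets of row vectors *)

Section topo.
Context {R : realType}.

Lemma nbhs_rect n (w : 'rV[R]_n) (A : 'I_n -> set R) :
  (forall i, nbhs (w 0 i) (A i)) -> nbhs w (rect A).
Proof.
move=> wA; exists (fun _ j => A j) => [i j|v Av j]; first by rewrite ord1.
exact: (Av 0).
Qed.

Lemma open_rect n (A : 'I_n -> set R) : (forall i, open (A i)) -> open (rect A).
Proof.
move=> oA; rewrite openE => w wA; apply: nbhs_rect => i.
by apply: open_nbhs_nbhs; split; [exact: oA|exact: wA].
Qed.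

Lemma closed_rect n (A : 'I_n -> set R) : (forall i, closed (A i)) -> closed (rect A).
Proof.
move=> cA; rewrite (_ : rect A = \bigcap_(i in [set: 'I_n])
    ((fun w : 'rV[R]_n => w 0 i) @^-1` A i)).
  apply: closed_bigI => i _; apply: preimage_closed => // w _.
  exact: coord_continuous.
by apply/seteqP; split => [w h i _|w h i]; exact: h.
Qed.

Lemma rat_nbhs (x : R) (A : set R) : nbhs x A -> exists pq : rat * rat,
  [/\ ratr pq.1 < x, x < ratr pq.2 & `]ratr pq.1, ratr pq.2[ `<=` A].
Proof.
move=> /nbhs_ballP[e/= e0 xeA].
have /rat_in_itvoo[p] : x - e < x by rewrite ltrBlDr ltrDl.
rewrite in_itv/= => /andP[px xp].
have /rat_in_itvoo[q] : x < x + e by rewrite ltrDl.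
rewrite in_itv/= => /andP[xq qx].
exists (p, q); split => //= y; rewrite /= in_itv/= => /andP[py yq].
apply: xeA; rewrite /ball/= ltr_distlC (lt_trans px py)//=.
exact: lt_trans qx.
Qed.

Definition open_boxes n : set (set 'rV[R]_n) :=
  [set B | exists p q : 'rV[R]_n, B = rect (fun i => `]p 0 i, q 0 i[%classic)].

(** Boxes with rational end points form a countable base of the topology. *)
Lemma open_sigma_open_boxes n (U : set 'rV[R]_n) : open U -> <<s @open_boxes n >> U.
Proof.
move=> oU.
pose B (s : {ffun 'I_n -> rat * rat}) : set 'rV[R]_n :=
  rect (fun i => `]ratr (s i).1, ratr (s i).2[%classic).
pose F s := if `[< B s `<=` U >] then B s else set0.
rewrite (_ : U = \bigcup_s F s).
  apply: (@countable_bigcupT_measurable _ (g_sigma_algebraType (@open_boxes n))) => // s.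
  rewrite /F; case: ifP => // _; apply: sub_sigma_algebra.
  exists (\row_i ratr (s i).1), (\row_i ratr (s i).2).
  by congr rect; apply/funext => i; rewrite !mxE.
apply/seteqP; split => [w Uw|w [s _]]; last first.
  by rewrite /F; case: asboolP => // + Bw; exact.
have [P wP PU] : nbhs w U by apply: open_nbhs_nbhs.
have /choice[s sP] := fun i : 'I_n => rat_nbhs (wP 0 i).
exists (finfun s) => //; rewrite /F; case: asboolP => [_ i|].
  by rewrite ffunE /= in_itv/=; have [-> ->] := sP i.
case=> v Bv; apply: PU => i j; rewrite ord1.
by have [_ _] := sP j; apply; have := Bv j; rewrite ffunE.
Qed.

(** The source carries the sigma-algebra generated by the open boxes, so that
    applying this to the coordinates compares that sigma-algebra with the
    one generated by the coordinates. *)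
Lemma continuous_measurable_open_boxes n (f : 'rV[R]_n -> R) : continuous f ->
  measurable_fun setT (f : g_sigma_algebraType (@open_boxes n) -> measurableTypeR R).
Proof.
move=> /continuousP cf; apply: (measurability _ (RGenOpens.measurableE R)).
move=> _ [_ [a [b ->] <-]]; rewrite setTI; apply: open_sigma_open_boxes.
exact/cf/interval_open.
Qed.

Lemma measurable_rV_open_boxes n : @measurable _ 'rV[R]_n = <<s @open_boxes n >>.
Proof.
apply/seteqP; split.
  apply: smallest_sub; first exact: smallest_sigma_algebra.
  rewrite -bigcup_seq => _ [i _ [B mB <-]].
  apply: (continuous_measurable_open_boxes _ measurableT) => //.
  exact: coord_continuous.
apply: smallest_sub; first exact: sigma_algebra_measurable.
by move=> _ [p [q ->]]; exact: measurable_rect.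
Qed.

Lemma setI_closed_open_boxes n : setI_closed (@open_boxes n).
Proof.
move=> _ _ [p [q ->]] [p' [q' ->]].
exists (\row_i Num.max (p 0 i) (p' 0 i)), (\row_i Num.min (q 0 i) (q' 0 i)).
apply/seteqP; split => [w [w1 w2] i|w ww].
  have := w1 i; have := w2 i; rewrite /= !mxE !in_itv/= gt_max lt_min.
  by move=> /andP[-> ->] /andP[-> ->].
by split => i; have := ww i; rewrite /= !mxE !in_itv/= gt_max lt_min
  => /andP[/andP[h1 h2] /andP[h3 h4]]; apply/andP.
Qed.

Lemma open_measurable_rV n (U : set 'rV[R]_n) : open U -> measurable U.
Proof. by move=> oU; rewrite measurable_rV_open_boxes; exact: open_sigma_open_boxes. Qed.

Lemma continuous_measurable_fun_rV n (f : 'rV[R]_n -> R) :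
  continuous f -> measurable_fun setT f.
Proof.
move=> cf _ Y mY; rewrite measurable_rV_open_boxes.
exact: (continuous_measurable_open_boxes cf).
Qed.

Lemma boxE n (a b : 'rV[R]_n) :
  box a b = rect (fun i => `[a 0 i, b 0 i]%classic).
Proof. by []. Qed.

Lemma measurable_box n (a b : 'rV[R]_n) : measurable (box a b).
Proof. by rewrite boxE; exact: measurable_rect. Qed.

Lemma interior_box n (a b : 'rV[R]_n) :
  (box a b)° = rect (fun i => `]a 0 i, b 0 i[%classic).
Proof.
apply/seteqP; split => [w [P wP Pab] i|w wab].
  have Pupd t : P 0 i t -> t \in `[a 0 i, b 0 i].
    move=> Pt; have : box a b (upd w i t).
      apply: Pab => k j; rewrite !ord1 mxE; case: eqP => [->//|_].
      exact: nbhs_singleton (wP 0 j).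
    by move=> /(_ i); rewrite mxE eqxx.
  have : nbhs (w 0 i) [set` `[a 0 i, b 0 i]] by apply: filterS (wP 0 i) => t /Pupd.
  by rewrite -[X in X -> _]/([set` `[a 0 i, b 0 i]]° _) interior_itv_bnd.
have : nbhs w (rect (fun i => `]a 0 i, b 0 i[%classic)).
  by apply: open_nbhs_nbhs; split => //; apply: open_rect => i; exact: interval_open.
by apply: filterS => v vab i; apply: subset_itv_oo_cc; exact: vab.
Qed.

End topo.

(** * Averaging one coordinate of a tensor product *)

Section integral_ae.
Context d (T : measurableType d) (R : realType) (mu : {measure set T -> \bar R}).
Import HBNNSimple.

Lemma le_integral_ae_ge0 (f g : T -> \bar R) :
  (forall x, 0 <= f x)%E -> (forall x, 0 <= g x)%E ->
  {ae mu, forall x, f x = g x} -> (\int[mu]_x f x <= \int[mu]_x g x)%E.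
Proof.
move=> f0 g0 [N [mN N0 fgN]].
rewrite ge0_integralTE// ge0_integralTE//; apply: ge_ereal_sup => _ [h /= hf <-].
have mNC := measurableC mN.
(* Replace [h] by its restriction to the complement of the null set. *)
apply: (@le_trans _ _ (sintegral mu (proj_nnsfun h mNC))); last first.
  apply: ereal_sup_ubound; exists (proj_nnsfun h mNC) => // x.
  rewrite -mrestrict patchE; case: ifPn => [xN|_]; last exact: g0.
  apply: le_trans (hf x) _; suff -> : f x = g x by [].
  by apply: contrapT => fg; move: xN; rewrite inE => /=; apply; apply: fgN.
rewrite -!integralT_nnsfun le_eqVlt; apply/orP; left; apply/eqP.
apply: ge0_ae_eq_integral => //.
- by apply/measurable_EFinP; exact: measurable_funP.
- by apply/measurable_EFinP; exact: measurable_funP.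
- by move=> x _; rewrite lee_fin.
- by move=> x _; rewrite lee_fin.
exists N; split => // x /= /not_implyP[_]; apply: contra_notP => xN.
by rewrite /= mindicE mem_set// mulr1.
Qed.

(** The integral of a nonnegative function is a supremum over the simple
    functions below it, and each of them can be made to vanish on the null set
    where [f] and [g] differ; no measurability is involved.  Slices of a function
    that is a tensor product almost everywhere may fail to be measurable. *)
Lemma ae_eq_integral_slice (D : set T) (f g : T -> \bar R) :
  {ae mu, forall x, D x -> f x = g x} ->
  (\int[mu]_(x in D) f x = \int[mu]_(x in D) g x)%E.
Proof.
move=> fg; have {}fg : {ae mu, forall x, (f \_ D) x = (g \_ D) x}.
  by apply: filterS fg => x fg; rewrite !patchE; case: ifPn => // /set_mem.
rewrite integral_mkcond [RHS]integral_mkcond integralE [RHS]integralE.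
congr (_ - _)%E; apply/eqP; rewrite eq_le; apply/andP; split;
  apply: le_integral_ae_ge0 => //; apply: filterS fg => x;
  by rewrite unlock => ->.
Qed.

End integral_ae.

Section upd.
Context {R : realType} (n : nat).
Implicit Types (a b w : 'rV[R]_n) (i : 'I_n).

Lemma box_upd a b w i t : box a b w -> side a b i t -> box a b (upd w i t).
Proof. by move=> Sw Jt j; rewrite mxE; case: eqP => [->//|_]; exact: Sw. Qed.

Lemma prod_upd (g : 'I_n -> R -> R) w i t :
  \prod_j g j (upd w i t 0 j) = (\prod_(j | j != i) g j (w 0 j)) * g i t.
Proof.
rewrite (bigD1 i)//= mulrC mxE eqxx; congr (_ * _).
by apply: eq_bigr => j ji; rewrite mxE (negbTE ji).
Qed.

Lemma measurable_side a b i : measurable (side a b i : set (measurableTypeR R)).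
Proof. exact: measurable_itv. Qed.

End upd.

Section P_op.
Context {R : realType} (n : nat).
Variables a b : 'rV[R]_n.+1.

(** On almost every line parallel to the [i]-th axis, [psi] is almost everywhere
    [g i] times a constant of the line. *)
Lemma Pi_op_prod i (g : 'I_n.+1 -> R -> R) psi :
  lebesgue_measure.-integrable (side a b i) (EFin \o g i) ->
  {ae lebesgue_rV n.+1, forall w, box a b w -> psi w = \prod_j g j (w 0 j)} ->
  {ae lebesgue_rV n.+1, forall w, box a b w ->
    Pi_op a b i psi w = (\prod_(j | j != i) g j (w 0 j)) * mean a b i (g i)}.
Proof.
move=> ig /(ae_upd i); apply: filterS => w aew Sw.
rewrite /Pi_op /mean [in LHS]/Rintegral.
have -> : (\int[lebesgue_measure]_(t in side a b i) (psi (upd w i t))%:E =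
    \int[lebesgue_measure]_(t in side a b i)
      ((\prod_(j | j != i) g j (w 0%R j)) * g i t)%:E)%E.
  apply: ae_eq_integral_slice.
  move: aew => [N [mN N0 subN]]; exists N; split => // t /= Nt.
  apply: subN => /= psit; apply: Nt => Jt; rewrite psit ?prod_upd//.
  exact: box_upd.
have := RintegralZl (\prod_(j | j != i) g j (w 0 j)) (measurable_side a b i) ig.
rewrite {1}/Rintegral => ->.
by rewrite mulrCA.
Qed.

(** The invariant is that each operator leaves a tensor product, in which only
    its own factor has changed; as [r] has no repetition, that factor was still
    the original one. *)
Lemma P_seq_prod (r : seq 'I_n.+1) (h : 'I_n.+1 -> R -> R) phi : uniq r ->
  (forall i, i \in r -> lebesgue_measure.-integrable (side a b i) (EFin \o h i)) ->
  {ae lebesgue_rV n.+1, forall w, box a b w -> phi w = \prod_j h j (w 0 j)} ->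
  {ae lebesgue_rV n.+1, forall w, box a b w ->
    (\big[comp/id]_(i <- r) (fun phi => phi \- Pi_op a b i phi)) phi w =
    \prod_j (h j (w 0 j) - if j \in r then mean a b j (h j) else 0)}.
Proof.
elim: r => [_ _ phiE|i r IH /= /andP[ir ur] ih phiE].
  apply: filterS phiE => w phiE Sw; rewrite big_nil/= phiE//.
  by apply: eq_bigr => j _; rewrite subr0.
have ir' j : j \in r -> j \in i :: r by rewrite inE orbC => ->.
have {}IH := IH ur (fun j jr => ih j (ir' j jr)) phiE.
pose g j t := h j t - if j \in r then mean a b j (h j) else 0.
have gi : g i = h i by apply/funext => t; rewrite /g (negbTE ir) subr0.
have := @Pi_op_prod i g _ _ IH; rewrite gi => /(_ (ih _ (mem_head _ _))).
apply: filterS2 IH => w IH PiE Sw; rewrite big_cons/= -/comp.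
rewrite [X in X - _]IH// PiE// [in RHS](bigD1 i)//= (bigD1 i)//= mem_head.
rewrite (negbTE ir) subr0 [in RHS]mulrBl; congr (_ - _); last first.
  rewrite mulrC; congr (_ * _); apply: eq_bigr => j ji.
  by rewrite /g inE (negbTE ji).
by congr (_ * _); apply: eq_bigr => j ji; rewrite inE (negbTE ji).
Qed.

Lemma P_op_prod (I : {set 'I_n.+1}) (h : 'I_n.+1 -> R -> R) phi :
  (forall i, i \in I -> lebesgue_measure.-integrable (side a b i) (EFin \o h i)) ->
  {ae lebesgue_rV n.+1, forall w, box a b w -> phi w = \prod_j h j (w 0 j)} ->
  {ae lebesgue_rV n.+1, forall w, box a b w ->
    P_op a b I phi w = (\prod_(i in I) (h i (w 0 i) - mean a b i (h i))) *
      (\prod_(j in ~: I) h j (w 0 j))}.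
Proof.
move=> ih phiE; rewrite /P_op -big_filter.
have memr j : (j \in [seq i <- index_enum 'I_n.+1 | i \in I]) = (j \in I).
  by rewrite mem_filter mem_index_enum andbT.
have := @P_seq_prod [seq i <- index_enum 'I_n.+1 | i \in I] h phi.
rewrite filter_uniq ?index_enum_uniq// => /(_ isT _ phiE) h1.
have : (forall i, i \in [seq i <- index_enum 'I_n.+1 | i \in I] ->
   lebesgue_measure.-integrable (side a b i) (EFin \o h i)).
  by move=> i; rewrite memr; exact: ih.
move=> /h1; apply: filterS => w PE Sw; rewrite PE// (bigID (mem I))/=.
congr (_ * _).
  by apply: eq_bigr => j jI; rewrite memr jI.
rewrite [RHS](eq_bigl (fun j => j \notin I)) => [|j]; last by rewrite finset.in_setC.
by apply: eq_bigr => j /negbTE jI; rewrite memr jI subr0.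
Qed.

Lemma Linfty_integrable i (h : R -> R) :
  Linfty_on lebesgue_measure (side a b i) h ->
  lebesgue_measure.-integrable (side a b i) (EFin \o h).
Proof.
rewrite /Linfty_on => /andP[]; rewrite !inE/= /finite_norm unlock => mh.
rewrite ifT; last first.
  rewrite (@lt_le_trans _ _ (lebesgue_measure `[0%R, 1%R : R]%classic)) //.
    by rewrite lebesgue_measure_itv/= lte_fin ltr01 oppr0 adde0 lte_fin.
  by apply: le_measure; rewrite ?inE.
rewrite -[abse \o _]/(EFin \o (fun t => `|(h \_ (side a b i)) t|)).
move=> /ess_sup_inf.ess_supr_bounded[M [N [mN N0 subN]]].
have mS := measurable_side a b i.
have mhS : measurable_fun (side a b i) h by apply/(measurable_restrictT _ mS).
have mhe : measurable_fun (side a b i) (EFin \o h) by apply/measurable_EFinP.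
apply/integrableP; split => //.
apply: (@le_lt_trans _ _ (\int[lebesgue_measure]_(t in side a b i) (cst `|M|%:E) t)%E).
  apply: ae_ge0_le_integral => //.
  - exact: measurableT_comp.
  - by move=> x _; rewrite /= lee_fin.
  exists N; split => // t /= /not_implyP[St hM].
  apply: subN => /= tM; apply: hM; rewrite lee_fin; move: tM.
  rewrite patchE mem_set// => /le_trans; apply; exact: ler_norm.
rewrite integral_cst//; apply: lte_mul_pinfty => //.
have : (lebesgue_measure (side a b i) < +oo)%E.
  by rewrite lebesgue_measure_itv/=; case: ifP => _; rewrite ?ltry.
exact.
Qed.

End P_op.

(** * Continuously differentiable functions on a segment *)

Section derive_in.
Context {R : realType}.
Implicit Types (c e u v x : R) (g : R -> R).

(** Limits within a segment are unique, also at its end points, where the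
    segment lies on one side only. *)
Lemma within_itv_proper c e x : c < e -> `[c, e]%classic x ->
  ProperFilter (within `[c, e]%classic x^').
Proof.
move=> ce; rewrite /= in_itv/= => /andP[cx xe].
apply: Build_ProperFilter_ex => P; move=> xP0.
have xP : \forall y \near nbhs x, y != x -> `[c, e]%classic y -> P y by exact: xP0.
have [xltE|ex] := ltP x e.
  have : \forall y \near x^'+, P y.
    near=> y; have : y != x -> `[c, e]%classic y -> P y.
      by near: y; exact: (@cvg_within _ (nbhs x) _ _ _ xP).
    apply; first by rewrite gt_eqF.
    by rewrite /= in_itv/= (le_trans cx)//= ltW.
  exact: (@filter_ex _ _ (at_right_proper_filter x)).
have : \forall y \near x^'-, P y.
  near=> y; have : y != x -> `[c, e]%classic y -> P y.
    by near: y; exact: (@cvg_within _ (nbhs x) _ _ _ xP).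
  apply; first by rewrite lt_eqF.
  have yx : y < x by [].
  rewrite /= in_itv/= (le_trans (ltW yx) xe) andbT.
  apply/ltW; near: y; apply: nbhs_left_gt; exact: lt_le_trans ce ex.
exact: (@filter_ex _ _ (at_left_proper_filter x)).
Unshelve. all: by end_near. Qed.

Lemma derive_in_eq c e g k x : `[c, e]%classic x ->
  (forall y, `[c, e]%classic y -> g y = k y) ->
  derive_in `[c, e] g x = derive_in `[c, e] k x.
Proof.
move=> Ax gk; rewrite /derive_in; congr lim.
apply/seteqP; split => P; apply: near_eq_cvg; near=> y; rewrite gk// ?gk//.
all: by near: y; exact: withinT.
Unshelve. all: by end_near. Qed.

Lemma derive_inZ c e g k x : c < e -> `[c, e]%classic x ->
  derivable_in `[c, e] g x ->
  derive_in `[c, e] (fun t => k * g t) x = k * derive_in `[c, e] g x.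
Proof.
move=> ce Ax dg; have FF := within_itv_proper ce Ax.
rewrite /derive_in; apply/cvg_lim => //.
rewrite (_ : (fun y => _) = (fun y => k * ((y - x)^-1 * (g y - g x)))).
  by apply: cvgMr.
by apply/funext => y; rewrite -mulrBr mulrCA.
Qed.

(** Near an interior point the constraint of staying in the segment is void. *)
Lemma derivable_in_interior c e g x : x \in `]c, e[ ->
  derivable_in `[c, e] g x ->
  is_derive x 1 g (derive_in `[c, e] g x).
Proof.
rewrite in_itv/= => /andP[cx xe] dg.
have ce := lt_trans cx xe.
have Ax : `[c, e]%classic x by rewrite /= in_itv/= !ltW.
have FF := within_itv_proper ce Ax.
have q_cvg : h^-1 * (g (h + x) - g x) @[h --> 0^'] --> derive_in `[c, e] g x.
  move=> P /dg xP0.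
  have xP : \forall y \near nbhs x, y != x -> `[c, e]%classic y ->
      P ((y - x)^-1 * (g y - g x)) by exact: xP0.
  have xA : nbhs x `]c, e[%classic.
    by apply: open_nbhs_nbhs; split; [exact: interval_open|rewrite /= in_itv/= cx].
  have /nbhs_ballP[r /= r0 rP] : nbhs x [set y | (y != x -> `[c, e]%classic y ->
      P ((y - x)^-1 * (g y - g x))) /\ `]c, e[%classic y] by exact: filterI xP xA.
  have : \forall h \near nbhs (0 : R), h != 0 -> P (h^-1 * (g (h + x) - g x)).
    apply/nbhs_ballP; exists r => //= h; rewrite /ball/= sub0r normrN => hr h0.
    have [] := rP (h + x); first by rewrite /ball/= opprD addrCA subrr addr0 normrN.
    rewrite -subr_eq0 addrK => + hA; apply => //.
    exact: subset_itv_oo_cc.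
  exact.
have dE : (fun h => h^-1 *: ((g \o shift x) (h *: 1) - g x)) =
    (fun h => h^-1 * (g (h + x) - g x)).
  by apply/funext => h /=; rewrite scaler1 /shift.
apply: DeriveDef; last by rewrite /derive dE; exact/cvg_lim.
by rewrite /derivable dE; apply/cvg_ex; eexists; exact: q_cvg.
Unshelve. all: by end_near. Qed.

Lemma integral_itv_oo_cc u v (h : R -> \bar R) :
  measurable_fun (`[u, v]%classic : set (measurableTypeR R)) h ->
  (\int[lebesgue_measure]_(t in `]u, v[) h t =
   \int[lebesgue_measure]_(t in `[u, v]) h t)%E.
Proof.
move=> mh.
have sub (X : set R) : X `<=` `[u, v]%classic ->
    measurable_fun (X : set (measurableTypeR R)) h.
  by move=> Xuv; apply: (measurable_funS _ Xuv mh); exact: measurable_itv.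
rewrite -[RHS]integral_itv_bndo_bndc; last first.
  by apply: sub; apply: subset_itvl; rewrite bnd_simp.
by rewrite -integral_itv_obnd_cbnd//; apply: sub; exact: subset_itv_oo_cc.
Qed.

Section C1.
Variables (c e : R) (g : R -> R).
Hypothesis ce : c < e.
Hypothesis gC1 : Ck_on `[c, e]%classic 1 g.
Let dg := derive_in `[c, e]%classic g.

Lemma C1_continuous : {within `[c, e], continuous g}. Proof. by case: gC1. Qed.

Lemma C1_continuous_derive : {within `[c, e], continuous dg}. Proof. by case: gC1 => _ [_ []]. Qed.

Lemma C1_is_derive x : x \in `]c, e[ -> is_derive x 1 g (dg x).
Proof.
case: gC1 => _ [+ _] xce => /(_ x) h; apply: derivable_in_interior => //.
by apply: h; exact: subset_itv_oo_cc.
Qed.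

Lemma C1_derivable_oo : derivable_oo_LRcontinuous g c e.
Proof.
have /(continuous_within_itvP _ ce)[_ gc ge] := C1_continuous.
by split => // x xce; have := C1_is_derive xce => ?; exact: ex_derive.
Qed.

Lemma C1_derive1 : {in `]c, e[, derive1 g =1 dg}.
Proof. by move=> x xce; rewrite derive1E; have := C1_is_derive xce => ?; exact: derive_val. Qed.

Lemma C1_sub u v : u < v -> c <= u -> v <= e ->
  [/\ {within `[u, v], continuous g}, {within `[u, v], continuous dg} &
     forall x, x \in `]u, v[ -> is_derive x 1 g (dg x)].
Proof.
move=> uv cu ve.
have uvce : `[u, v]%classic `<=` `[c, e]%classic by apply: subset_itvScc; rewrite bnd_simp.
split.
- exact: continuous_subspaceW C1_continuous.
- exact: continuous_subspaceW C1_continuous_derive.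
move=> x; rewrite in_itv/= => /andP[ux xv]; apply: C1_is_derive.
by rewrite in_itv/= (le_lt_trans cu)//= (lt_le_trans xv).
Qed.

Lemma C1_FTC u v : u < v -> c <= u -> v <= e ->
  (\int[lebesgue_measure]_(t in `[u, v]) (dg t)%:E = (g v - g u)%:E)%E.
Proof.
move=> uv cu ve; have [cg' cdg' der'] := C1_sub uv cu ve.
rewrite (continuous_FTC2 uv cdg' (F := g)) ?EFinB//.
  have /(continuous_within_itvP _ uv)[_ gu gv] := cg'.
  by split => // x xuv; have := der' _ xuv => ?; exact: ex_derive.
by move=> x xuv; rewrite derive1E; have := der' _ xuv => ?; exact: derive_val.
Qed.

Lemma C1_measurable : measurable_fun (`[c, e]%classic : set (measurableTypeR R)) dg.
Proof.
apply: subspace_continuous_measurable_fun; first exact: measurable_itv.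
exact: C1_continuous_derive.
Qed.

Lemma C1_integrable : lebesgue_measure.-integrable `[c, e] (EFin \o dg).
Proof.
apply: continuous_compact_integrable; first exact: segment_compact.
exact: C1_continuous_derive.
Qed.

Lemma C1_variation_fin :
  (\int[lebesgue_measure]_(t in `[c, e]) `|dg t|%:E < +oo)%E.
Proof. by have /integrableP[] := C1_integrable. Qed.

Lemma C1_increment_le u v : u < v -> c <= u -> v <= e ->
  (`|g v - g u|%:E <= \int[lebesgue_measure]_(t in `[u, v]) `|dg t|%:E)%E.
Proof.
move=> uv cu ve; have [_ cdg' _] := C1_sub uv cu ve.
have := @le_abse_integral _ _ _ lebesgue_measure `[u, v] (EFin \o dg).
rewrite C1_FTC//; apply => //.
by apply/measurable_EFinP; exact: subspace_continuous_measurable_fun.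
Qed.

(** Heine-Cantor, through the covering form of the compactness of the segment. *)
Lemma C1_unif_continuous (eta : R) : 0 < eta ->
  exists2 delta : R, 0 < delta & forall x y, `[c, e]%classic x -> `[c, e]%classic y ->
    `|x - y| < delta -> `|dg x - dg y| < eta.
Proof.
move=> eta0; pose P (delta x : R) := `[c, e]%classic x -> forall y, `[c, e]%classic y ->
  `|x - y| < delta -> `|dg x - dg y| < eta.
have nearP (x : R) : `[c, e]%classic x -> \forall x' \near x & delta \near 0^'+, P delta x'.
  move=> Ax.
  have /subspace_continuousP/(_ x Ax) := C1_continuous_derive.
  move=> /cvgrPdist_lt/(_ (eta / 2)); rewrite divr_gt0// => /(_ isT) dgx.
  have {}dgx : \forall y \near nbhs x, `[c, e]%classic y -> `|dg x - dg y| < eta / 2.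
    exact: dgx.
  have /nbhs_ballP[r /= r0 rdg] := dgx.
  have r20 : 0 < r / 2 by rewrite divr_gt0.
  (* Halving the radius keeps [x'] and [y] both within [r] of [x]. *)
  exists (ball x (r / 2), [set delta | delta < r / 2]).
    split => /=; first exact: nbhsx_ballx.
    exact: nbhs_right_lt.
  move=> [x' delta]/= [xx' dr] Ax' y Ay x'y.
  have xy : ball x r y.
    rewrite /ball/= (splitr r) -(subrKA x') (le_lt_trans (ler_normD _ _))//.
    by rewrite ltrD// (lt_trans x'y).
  have := rdg _ xy Ay.
  have : ball x r x' by apply: le_ball xx'; rewrite [leRHS]splitr lerDl ltW.
  move=> /rdg/(_ Ax') h1 h2.
  rewrite (splitr eta) -(subrKA (dg x)) (le_lt_trans (ler_normD _ _))//.
  by rewrite ltrD// distrC.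
have /compact_near_coveringP/(_ R 0^'+ P _ nearP) h := @segment_compact R c e.
have : \forall delta \near (0 : R)^'+, 0 < delta /\ `[c, e]%classic `<=` P delta.
  by near=> delta; split => //; near: delta; exact: h.
move=> /(@filter_ex _ _ (at_right_proper_filter (0 : R)))[delta [d0 dP]].
by exists delta => // x y Ax Ay xy; exact: dP xy.
Unshelve. all: by end_near. Qed.

Lemma C1_variation_split u v w : c <= u -> u <= v -> v <= w -> w <= e ->
  (\int[lebesgue_measure]_(t in `[u, w]) `|dg t|%:E =
   \int[lebesgue_measure]_(t in `[u, v]) `|dg t|%:E +
   \int[lebesgue_measure]_(t in `[v, w]) `|dg t|%:E)%E.
Proof.
move=> cu uv vw we.
have mdg (A : set R) : A `<=` `[u, w] ->
    measurable_fun (A : set (measurableTypeR R)) (fun t => `|dg t|%:E).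
  move=> Auw; apply/measurable_EFinP/measurableT_comp => //.
  apply: (measurable_funS _ _ C1_measurable) => //.
  apply: (subset_trans Auw); apply: subset_itvScc; rewrite bnd_simp//.
have -> : `[u, w]%classic = `[u, v]%classic `|` `]v, w]%classic :> set R.
  by apply: itv_bndbnd_setU; rewrite bnd_simp.
rewrite ge0_integral_setU//.
- rewrite integral_itv_obnd_cbnd//; apply: mdg.
  move=> t /=; rewrite !in_itv/= => /andP[vt ->].
  by rewrite andbT (le_trans uv)// ltW.
- apply: mdg; rewrite -itv_bndbnd_setU ?bnd_simp//.
- apply/disj_setPS => t [] /=; rewrite !in_itv/= => /andP[_ +] /andP[+ _].
  by move=> /le_lt_trans h /h; rewrite ltxx.
Qed.

(** By the mean value theorem the increment is [dg xi * (v - u)] for some [xi],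
    and [|dg|] exceeds [|dg xi|] by at most [eta] on the piece. *)
Lemma C1_variation_piece (eta : R) u v : u < v -> c <= u -> v <= e ->
  (forall s t, `[u, v]%classic s -> `[u, v]%classic t -> `|dg s - dg t| < eta) ->
  (\int[lebesgue_measure]_(t in `[u, v]) `|dg t|%:E <=
    (`|g v - g u| + eta * (v - u))%:E)%E.
Proof.
move=> uv cu ve osc; have [cg' cdg' der'] := C1_sub uv cu ve.
have [xi xiuv ->] := MVT uv der' cg'.
have xiuv' : `[u, v]%classic xi by exact: subset_itv_oo_cc.
apply: (@le_trans _ _ (\int[lebesgue_measure]_(t in `[u, v]) (cst (`|dg xi| + eta)%:E) t)%E).
  apply: ge0_le_integral => //.
  - by apply/measurable_EFinP/measurableT_comp => //; exact: subspace_continuous_measurable_fun.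
  move=> t tuv; rewrite lee_fin -[dg t](subrK (dg xi)) (le_trans (ler_normD _ _))//.
  by rewrite addrC lerD2l ltW// osc.
rewrite integral_cst// [X in (_ * X)%E](_ : _ = (v - u)%:E); last first.
  by rewrite -[LHS]/(lebesgue_measure `[u, v]%classic) lebesgue_measure_itv/= lte_fin uv -EFinB.
rewrite -EFinM lee_fin.
by rewrite normrM (gtr0_norm (x := v - u)) ?subr_gt0// mulrDl.
Qed.

Definition grid n (k : nat) : R := c + k%:R * ((e - c) / n.+1%:R).

Definition grid_variation n : R :=
  \sum_(k < n.+1) `|g (grid n k.+1) - g (grid n k)|.

Lemma grid0 n : grid n 0 = c.
Proof. by rewrite /grid mul0r addr0. Qed.

Lemma grid_last n : grid n n.+1 = e.
Proof. by rewrite /grid mulrC divfK ?pnatr_eq0// subrKC. Qed.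

Lemma ler_grid n k l : (k <= l)%N -> grid n k <= grid n l.
Proof.
move=> kl; rewrite /grid lerD2l ler_wpM2r ?ler_nat//.
by rewrite divr_ge0// subr_ge0 ltW.
Qed.

Lemma ltr_grid n k l : (k < l)%N -> grid n k < grid n l.
Proof.
move=> kl; rewrite /grid ltrD2l ltr_pM2r ?ltr_nat//.
by rewrite divr_gt0// subr_gt0.
Qed.

Lemma grid_ge n k : c <= grid n k.
Proof. by rewrite -[leLHS](grid0 n) ler_grid. Qed.

Lemma grid_le n k : (k <= n.+1)%N -> grid n k <= e.
Proof. by move=> kn; rewrite -[leRHS](grid_last n) ler_grid. Qed.

Lemma gridS n k : grid n k.+1 - grid n k = (e - c) / n.+1%:R.
Proof. by rewrite /grid opprD addrACA subrr add0r -mulrBl -natrB// subSnn mul1r. Qed.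

Lemma grid_partial_le n k : (k <= n.+1)%N ->
  ((\sum_(j < k) `|g (grid n j.+1) - g (grid n j)|)%:E <=
   \int[lebesgue_measure]_(t in `[c, grid n k]) `|dg t|%:E)%E.
Proof.
elim: k => [_|k IH kn]; first by rewrite big_ord0 integral_ge0.
rewrite big_ord_recr/= EFinD (@C1_variation_split _ (grid n k)) ?grid_ge ?ler_grid ?grid_le//.
apply: leeD; first by apply: IH; exact: ltnW.
by apply: C1_increment_le; rewrite ?ltr_grid ?grid_ge ?grid_le.
Qed.

Lemma grid_partial_ge (eta : R) n k : (k <= n.+1)%N ->
  (forall s t, `[c, e]%classic s -> `[c, e]%classic t ->
    `|s - t| <= (e - c) / n.+1%:R -> `|dg s - dg t| < eta) ->
  (\int[lebesgue_measure]_(t in `[c, grid n k]) `|dg t|%:E <=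
   (\sum_(j < k) `|g (grid n j.+1) - g (grid n j)| + eta * (grid n k - c))%:E)%E.
Proof.
move=> + osc; elim: k => [_|k IH kn].
  by rewrite big_ord0 grid0 set_itv1 integral_set1 subrr mulr0 addr0.
rewrite (@C1_variation_split _ (grid n k)) ?grid_ge ?ler_grid ?grid_le//.
have piece : (\int[lebesgue_measure]_(t in `[grid n k, grid n k.+1]) `|dg t|%:E <=
    (`|g (grid n k.+1) - g (grid n k)| + eta * (grid n k.+1 - grid n k))%:E)%E.
  apply: C1_variation_piece; rewrite ?ltr_grid ?grid_ge ?grid_le// => s t sk tk.
  have sub x : `[grid n k, grid n k.+1]%classic x -> `[c, e]%classic x.
    apply: subset_itvScc; rewrite bnd_simp; [exact: grid_ge|exact: grid_le].
  apply: osc; [exact: sub|exact: sub|rewrite -(gridS n k)].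
  move: sk tk; rewrite /= !in_itv/= => /andP[ks sk] /andP[kt tk].
  by rewrite ler_norml; apply/andP; split; lra.
apply: (le_trans (leeD (IH (ltnW kn)) piece)).
rewrite -EFinD lee_fin big_ord_recr/=; lra.
Qed.

Lemma grid_variation_le n :
  ((grid_variation n)%:E <= \int[lebesgue_measure]_(t in `[c, e]) `|dg t|%:E)%E.
Proof. by rewrite -[X in `[_, X]](grid_last n); exact: grid_partial_le. Qed.

(** The grid sums are at most the integral, and at least the integral up to
    [eps] as soon as the mesh is small enough for [dg] to oscillate by less than
    [eps / (e - c)] on each cell. *)
Lemma grid_variation_cvg : (grid_variation n @[n --> \oo]) -->
  fine (\int[lebesgue_measure]_(t in `[c, e]) `|dg t|%:E)%E.
Proof.
have ec0 : 0 < e - c by rewrite subr_gt0.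
have fineL : (fine (\int[lebesgue_measure]_(t in `[c, e]) `|dg t|%:E))%:E =
    (\int[lebesgue_measure]_(t in `[c, e]) `|dg t|%:E)%E.
  by rewrite fineK// ge0_fin_numE ?C1_variation_fin// integral_ge0.
apply/cvgrPdist_le => eps eps0.
have [delta d0 osc] := C1_unif_continuous (divr_gt0 eps0 ec0).
have [N Nlarge] : exists N : nat, forall n, (N <= n)%N -> (e - c) / n.+1%:R < delta.
  exists (Num.truncn ((e - c) / delta)) => n Nn.
  rewrite ltr_pdivrMr// mulrC -ltr_pdivrMr//.
  by rewrite (lt_le_trans (truncnS_gt _))// ler_nat.
exists N => // n /= Nn; rewrite ger0_norm; last first.
  by rewrite subr_ge0 -lee_fin fineL grid_variation_le.
rewrite lerBlDl -lee_fin fineL -[X in `[_, X]](grid_last n).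
have := @grid_partial_ge (eps / (e - c)) n n.+1 (leqnn _).
rewrite grid_last divfK ?gt_eqF//; apply => s t Is It st; apply: osc => //.
exact: le_lt_trans (Nlarge n Nn).
Qed.

End C1.

End derive_in.

(** * Mixed derivatives and Vitali variation of a tensor product *)

Lemma lee_prod (R : realDomainType) (J : Type) (r : seq J) (P : pred J) (F G : J -> \bar R) :
  (forall j, P j -> 0 <= F j <= G j)%E ->
  (\prod_(j <- r | P j) F j <= \prod_(j <- r | P j) G j)%E.
Proof.
move=> FG; suff /andP[] : (0 <= \prod_(j <- r | P j) F j <= \prod_(j <- r | P j) G j)%E by [].
elim/big_ind2 : _ => //; first by rewrite lexx lee01.
move=> x1 x2 y1 y2 /andP[x10 x12] /andP[y10 y12].
by rewrite mule_ge0//= lee_pmul.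
Qed.

Lemma grid_cover (R : realType) (c e x : R) N : c < e -> x \in `[c, e] ->
  exists k : 'I_N.+1, x \in `[grid c e N k, grid c e N k.+1].
Proof.
move=> ce; rewrite in_itv/= => /andP[cx xe].
suff H k : (k <= N)%N -> x <= grid c e N k.+1 ->
    exists2 j, (j <= k)%N & x \in `[grid c e N j, grid c e N j.+1].
  have [|j jN xj] := H N (leqnn _); first by rewrite grid_last.
  by exists (Ordinal (jN : (j < N.+1)%N)).
elim: k => [_ x1|k IH kN xk].
  by exists 0%N => //; rewrite in_itv/= grid0 cx.
have [xle|lex] := leP x (grid c e N k.+1).
  by have [j jk xj] := IH (ltnW kN) xle; exists j => //; exact: leqW.
by exists k.+1 => //; rewrite in_itv/= (ltW lex).
Qed.

Section product.
Context {R : realType} (n : nat).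
Variables (a b : 'rV[R]_n) (g : 'I_n -> R -> R) (f : 'rV[R]_n -> R).
Hypothesis ab : forall i, a 0 i < b 0 i.
Hypothesis fE : forall w, box a b w -> f w = \prod_j g j (w 0 j).
Let dg i := derive_in (side a b i) (g i).

Lemma partial_in_prod (h : 'I_n -> R -> R) (k : 'rV[R]_n -> R) i (w : 'rV[R]_n) :
  (forall w, box a b w -> k w = \prod_j h j (w 0 j)) ->
  derivable_in (side a b i) (h i) (w 0 i) -> box a b w ->
  partial_in a b i k w =
  derive_in (side a b i) (h i) (w 0 i) * \prod_(j | j != i) h j (w 0 j).
Proof.
move=> kE dh Sw; rewrite /partial_in.
rewrite (@derive_in_eq _ _ _ _ (fun t => (\prod_(j | j != i) h j (w 0 j)) * h i t)); last 2 first.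
- exact: Sw.
- by move=> t It; rewrite kE ?prod_upd//; exact: box_upd.
by rewrite derive_inZ//; [exact: mulrC|exact: Sw].
Qed.

(** Each derivative acts on its own factor; the point stays in the box, where
    [f] is the tensor product. *)
Lemma partials_seq_prod (r : seq 'I_n) (w : 'rV[R]_n) : uniq r ->
  (forall i, i \in r -> forall t, side a b i t -> derivable_in (side a b i) (g i) t) ->
  box a b w ->
  (\big[comp/id]_(i <- r) partial_in a b i) f w =
  \prod_j (if j \in r then dg j (w 0 j) else g j (w 0 j)).
Proof.
elim: r w => [|i r IH] w /=; first by move=> _ _ Sw; rewrite big_nil/= fE.
move=> /andP[ir ur] dr Sw; rewrite big_cons/=.
pose h j := if j \in r then dg j else g j.
rewrite (@partial_in_prod h) //.
- rewrite [RHS](bigD1 i)//= mem_head /h (negbTE ir); congr (_ * _).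
  by apply: eq_bigr => j ji; rewrite inE (negbTE ji)/=; case: ifP.
- move=> v Sv; rewrite IH//; last by move=> j jr; apply: dr; rewrite inE jr orbT.
  by apply: eq_bigr => j _; rewrite /h; case: ifP.
- by rewrite /h (negbTE ir); apply: dr; [exact: mem_head|exact: Sw].
Qed.

Lemma partials_in_prod (I : {set 'I_n}) (w : 'rV[R]_n) :
  (forall i, i \in I -> forall t, side a b i t -> derivable_in (side a b i) (g i) t) ->
  box a b w ->
  partials_in a b I f w = \prod_j (if j \in I then dg j (w 0 j) else g j (w 0 j)).
Proof.
move=> dI Sw; rewrite /partials_in -big_filter.
have memr j : (j \in [seq i <- index_enum 'I_n | i \in I]) = (j \in I).
  by rewrite mem_filter mem_index_enum andbT.
rewrite partials_seq_prod ?filter_uniq ?index_enum_uniq//.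
  by apply: eq_bigr => j _; rewrite memr.
by move=> i; rewrite memr; exact: dI.
Qed.

Lemma prod_EFin (J : Type) (r : seq J) (P : pred J) (F : J -> R) :
  (\prod_(j <- r | P j) (F j)%:E = (\prod_(j <- r | P j) F j)%:E)%E.
Proof. by elim/big_rec2 : _ => // j x y _ ->; rewrite EFinM. Qed.

Hypothesis gC1 : forall i, Ck_on (side a b i) 1 (g i).

Let L i := (\int[lebesgue_measure]_(t in side a b i) `|dg i t|%:E)%E.

Lemma measurable_fun_side i :
  measurable_fun (side a b i : set (measurableTypeR R)) (g i).
Proof.
apply: subspace_continuous_measurable_fun; first exact: measurable_side.
exact: (C1_continuous (gC1 i)).
Qed.

Lemma integral_partials_in (I : {set 'I_n}) :
  (forall j, prob_density (side a b j) (g j)) ->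
  (\int[lebesgue_rV n]_(w in box a b) `|partials_in a b I f w|%:E =
   \prod_(i in I) L i)%E.
Proof.
move=> dens.
have mdg i : measurable_fun (side a b i : set (measurableTypeR R)) (dg i).
  exact: (C1_measurable (gC1 i)).
pose h j t : \bar R := if j \in I then `|dg j t|%:E else (g j t)%:E.
transitivity (\int[lebesgue_rV n]_(w in rect (side a b)) \prod_j h j (w 0%R j))%E.
  apply: eq_integral => w; rewrite inE => Sw.
  rewrite partials_in_prod//; last first.
    by move=> i _ t; case: (gC1 i) => _ [+ _]; exact.
  rewrite normr_prod -prod_EFin; apply: eq_bigr => j _; rewrite /h.
  case: ifP => // _; rewrite ger0_norm//.
  by have [+ _] := dens j; apply; exact: Sw.
rewrite integral_prod_rect.
- rewrite (bigID (mem I))/= [X in (_ * X)%E]big1 ?mule1.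
    by apply: eq_bigr => j jI; apply: eq_integral => t _; rewrite /h jI.
  move=> j /negbTE jI; rewrite /h; under eq_integral do rewrite jI.
  by have [_] := dens j.
- by move=> i; exact: measurable_side.
- move=> i; rewrite /h; case: (i \in I); apply/measurable_EFinP.
    by apply: measurableT_comp => //; exact: mdg.
  exact: measurable_fun_side.
- move=> i t It; rewrite /h; case: ifP => _; rewrite lee_fin//.
  by have [+ _] := dens i; exact.
Qed.

(** Expanding the product of the differences gives the signed sum over the
    corners. *)
Lemma box_increment_prod (lo hi : 'rV[R]_n) : (forall l, lo 0 l <= hi 0 l) ->
  box lo hi `<=` box a b ->
  box_increment f lo hi = \prod_l (g l (hi 0 l) - g l (lo 0 l)).
Proof.
move=> lohi sub; rewrite /box_increment.
transitivity (\sum_(nu : {ffun 'I_n -> bool}) \prod_l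
    ((-1) ^+ (nu l) * g l (if nu l then lo 0 l else hi 0 l))).
  apply: eq_bigr => nu _; rewrite big_split/=; congr (_ * _).
    by elim/big_rec2 : _ => //= l x y _ <-; rewrite exprD.
  rewrite fE.
    apply: eq_bigr => l _; rewrite mxE; congr (g l _).
    by case: (nu l); rewrite ?mul1r ?mul0r ?addr0// addrC subrK.
  apply: sub => l; rewrite mxE in_itv/=.
  by case: (nu l); rewrite ?mul1r ?mul0r ?addr0 ?subrKC ?lexx ?lohi.
rewrite -(bigA_distr_bigA (fun l (c : bool) => (-1) ^+ c * g l (if c then lo 0 l else hi 0 l))).
apply: eq_bigr => l _; rewrite big_bool/= expr1 expr0 mul1r mulN1r addrC.
by [].
Qed.

(** The density of the Vitali variation, extended by zero to be measurable on
    the whole space. *)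
Let F (w : 'rV[R]_n) := (\prod_j ((fun t => `|dg j t|%:E) \_ (side a b j)) (w 0%R j))%E.

Lemma measurable_variation_density : measurable_fun setT F.
Proof.
apply: emeasurable_prod => i _; apply: (measurable_comp_coord (n := n)).
apply/(measurable_restrictT _ _).1; first exact: measurable_side.
apply/measurable_EFinP; apply: measurableT_comp => //.
exact: (C1_measurable (gC1 i)).
Qed.

Lemma variation_density_ge0 w : (0 <= F w)%E.
Proof.
by apply: prod_ge0_ereal => j _; rewrite patchE; case: ifP => //; rewrite lee_fin.
Qed.

Lemma integral_variation_density_rect (A : 'I_n -> set R) :
  (forall i, measurable (A i)) -> (forall i, A i `<=` side a b i) ->
  (\int[lebesgue_rV n]_(w in rect A) F w =
   \prod_i \int[lebesgue_measure]_(t in A i) `|dg i t|%:E)%E.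
Proof.
move=> mA Aab.
rewrite (integral_prod_rect (g := fun j => (fun t => `|dg j t|%:E) \_ (side a b j)))//.
- apply: eq_bigr => i _; apply: eq_integral => t; rewrite inE => At.
  by rewrite patchE mem_set//; exact: Aab.
- move=> i; apply: measurable_funTS.
  apply/(measurable_restrictT _ _).1; first exact: measurable_side.
  apply/measurable_EFinP; apply: measurableT_comp => //.
  exact: (C1_measurable (gC1 i)).
- by move=> i t _; rewrite patchE; case: ifP => //; rewrite lee_fin.
Qed.

(** The bound is over the interior of the box, since the boxes of a partition
    are disjoint up to their boundaries only. *)
Lemma box_increment_le (lo hi : 'rV[R]_n) : (forall l, lo 0 l < hi 0 l) ->
  box lo hi `<=` box a b ->
  (`|box_increment f lo hi|%:E <= \int[lebesgue_rV n]_(w in (box lo hi)°) F w)%E.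
Proof.
move=> lohi sub.
have alo l : a 0 l <= lo 0 l.
  have : box lo hi lo by move=> k; rewrite in_itv/= lexx ltW.
  by move=> /sub /(_ l); rewrite in_itv/= => /andP[].
have hib l : hi 0 l <= b 0 l.
  have : box lo hi hi by move=> k; rewrite in_itv/= lexx ltW.
  by move=> /sub /(_ l); rewrite in_itv/= => /andP[].
have subl l : `]lo 0 l, hi 0 l[%classic `<=` side a b l.
  apply: (@subset_trans _ `[lo 0 l, hi 0 l]%classic); first exact: subset_itv_oo_cc.
  by apply: subset_itvScc; rewrite bnd_simp.
rewrite interior_box integral_variation_density_rect//.
rewrite box_increment_prod//; last by move=> l; exact: ltW.
rewrite normr_prod -prod_EFin; apply: lee_prod => l _; rewrite lee_fin normr_ge0/=.
apply: (le_trans (C1_increment_le (gC1 l) (lohi l) (alo l) (hib l))).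
rewrite integral_itv_oo_cc//; apply/measurable_EFinP; apply: measurableT_comp => //.
apply: (measurable_funS _ _ (C1_measurable (gC1 l))); first exact: measurable_side.
by apply: subset_itvScc; rewrite bnd_simp.
Qed.

Lemma vitali_variation_prod_le :
  (vitali_variation f (box a b) <= \prod_(i < n) L i)%E.
Proof.
apply: ge_ereal_sup => _ [m [lo [hi [[lohi triv cover] ->]]]].
have sub j : box (lo j) (hi j) `<=` box a b by move=> w wj; rewrite -cover; exists j.
have mint j : measurable ((box (lo j) (hi j))°).
  by apply: open_measurable_rV; exact: open_interior.
rewrite -sumEFin.
apply: (@le_trans _ _ (\sum_(j < m) \int[lebesgue_rV n]_(w in (box (lo j) (hi j))°) F w)%E).
  by apply: lee_sum => j _; exact: box_increment_le.
rewrite -ge0_integral_bigsetU//=; last 4 first.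
- exact: index_enum_uniq.
- exact: (sub_trivIset _ triv).
- exact: (measurable_funTS measurable_variation_density).
- by move=> w _; exact: variation_density_ge0.
rewrite -(integral_variation_density_rect (A := side a b)); last 2 first.
- by move=> i; exact: measurable_side.
- by move=> i t.
apply: ge0_subset_integral.
- by apply: bigsetU_measurable => j _; exact: mint.
- exact: measurable_box.
- exact: (measurable_funTS measurable_variation_density).
- by move=> w _; exact: variation_density_ge0.
- rewrite -bigcup_seq => w [j _ wj]; apply: (sub j); exact: interior_subset.
Qed.

Lemma box_partition_grid N : box_partition (box a b)
  (fun j : 'I_#|{: {ffun 'I_n -> 'I_N.+1}}| =>
     \row_l grid (a 0 l) (b 0 l) N (enum_val j l))
  (fun j => \row_l grid (a 0 l) (b 0 l) N (enum_val j l).+1).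
Proof.
split => [j l| |].
- by rewrite !mxE ltr_grid.
- apply/trivIsetP => i j _ _ ij; apply/seteqP; split => // w [].
  rewrite !interior_box => wi wj.
  have : enum_val i != enum_val j by apply: contra_neq ij; exact: enum_val_inj.
  move=> /eqP /ffunP /existsNP[l /eqP nl].
  have := wi l; have := wj l; rewrite /= !mxE !in_itv/= => /andP[j1 j2] /andP[i1 i2].
  move: nl; rewrite -(inj_eq val_inj) neq_ltn => /orP[] /= h.
    have /(ler_grid (ab l) N) := h; move: (lt_trans j1 i2); rewrite ltNge => /negP; exact.
  have /(ler_grid (ab l) N) := h; move: (lt_trans i1 j2); rewrite ltNge => /negP; exact.
- apply/seteqP; split => [w [j _ wj] l|w wab].
    have := wj l; rewrite !mxE !in_itv/= => /andP[h1 h2].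
    rewrite (le_trans (grid_ge (ab l) _ _) h1)/= (le_trans h2)//.
    by apply: grid_le.
  have /choice[s sP] : forall l, exists k : 'I_N.+1,
      w 0 l \in `[grid (a 0 l) (b 0 l) N k, grid (a 0 l) (b 0 l) N k.+1].
    by move=> l; apply: grid_cover => //; exact: wab.
  exists (enum_rank (finfun s)) => // l; rewrite !mxE enum_rankK ffunE; exact: sP.
Qed.

(** By distributivity, the sum over the cells of a product grid is the product
    of the one-dimensional sums. *)
Lemma vitali_variation_prod_ge N :
  ((\prod_(l < n) grid_variation (a 0 l) (b 0 l) (g l) N)%:E <=
   vitali_variation f (box a b))%E.
Proof.
apply: ereal_sup_ubound; do 3 eexists; split; first exact: (box_partition_grid N).
have [lohi _ cover] := box_partition_grid N.
congr EFin; rewrite /grid_variation bigA_distr_bigA/=.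
rewrite [LHS](reindex (@enum_val {ffun 'I_n -> 'I_N.+1} predT))/=; last first.
  exact/onW_bij/enum_val_bij.
apply: eq_bigr => j _; rewrite box_increment_prod; last 2 first.
- by move=> l; exact: ltW.
- by move=> w wj; rewrite -cover; exists j.
by rewrite normr_prod; apply: eq_bigr => l _; rewrite !mxE.
Qed.

Lemma cvg_prod_fin (J : Type) (r : seq J) (u : J -> nat -> R) (l : J -> R) :
  (forall j, u j k @[k --> \oo] --> l j) ->
  \prod_(j <- r) u j k @[k --> \oo] --> \prod_(j <- r) l j.
Proof.
move=> ul; elim: r => [|j r IH].
  by rewrite big_nil; under eq_fun do rewrite big_nil; exact: cvg_cst.
by rewrite big_cons; under eq_fun do rewrite big_cons; exact: cvgM.
Qed.

Lemma vitali_variation_prod : (vitali_variation f (box a b) = \prod_(i < n) L i)%E.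
Proof.
apply/eqP; rewrite eq_le vitali_variation_prod_le/=.
have LE l : (fine (L l))%:E = L l.
  rewrite fineK// ge0_fin_numE; last exact: integral_ge0.
  exact: (C1_variation_fin (gC1 l)).
have := @cvg_prod_fin _ (index_enum 'I_n) _ _ (fun l => grid_variation_cvg (ab l) (gC1 l)).
rewrite -(eq_bigr _ (fun l _ => LE l)) prod_EFin => ul.
have := vitali_variation_prod_ge; case: (vitali_variation _ _) => [v| |] vN.
- rewrite lee_fin; apply: (cvgr_to_le ul); apply: nearW => N.
  by rewrite -lee_fin; exact: vN.
- by rewrite leey.
- by have := vN 0%N; rewrite leeNy_eq.
Qed.

End product.

(** * Smooth approximation of the indicator of an open box *)

Section flat.
Context {R : realType}.
Implicit Types (p q : {poly R}) (x y : R).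

(** The functions [p(1/x) exp(-1/x)], extended by [0]: in contrast with the sole
    [exp(-1/x)], this family is stable under differentiation. *)
Definition flat p x : R := if 0 < x then p.[x^-1] * expR (- x^-1) else 0.

(** Raise [y / k <= exp (y / k)] to the power [k]. *)
Lemma pow_expRN_le (k : nat) y : 0 <= y -> y ^+ k * expR (- y) <= k%:R ^+ k.
Proof.
move=> y0; case: k => [|k]; first by rewrite !expr0 mul1r -expR0 ler_expR oppr_le0.
rewrite expRN ler_pdivrMr ?expR_gt0//.
have k0 : (k.+1%:R : R) != 0 by rewrite pnatr_eq0.
rewrite [in expR y](_ : y = k.+1%:R * (y / k.+1%:R)); last by rewrite mulrC divfK.
rewrite expRM_natl -exprMn lerXn2r ?nnegrE//.
rewrite -[leLHS](divfK k0) mulrC ler_pM2l ?ltr0n//.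
by apply: le_trans (expR_ge1Dx _); rewrite lerDr.
Qed.

Lemma poly_expR_bounded p : exists C, forall y, 0 <= y -> `|p.[y]| * expR (- y) <= C.
Proof.
exists (\sum_(k < size p) `|p`_k| * k%:R ^+ k) => y y0.
rewrite horner_coef (le_trans (ler_wpM2r (expR_ge0 _) (ler_norm_sum _ _ _)))//.
rewrite mulr_suml; apply: ler_sum => k _.
rewrite normrM normrX (ger0_norm y0) -mulrA ler_wpM2l//.
exact: pow_expRN_le.
Qed.

(** A quadratic bound makes [flat p] differentiable at [0], with derivative [0]. *)
Lemma flat_quadratic p : exists C, forall x, `|flat p x| <= C * x ^+ 2.
Proof.
have [C Cb] := poly_expR_bounded ('X^2 * p); exists C => x.
rewrite /flat; case: ifP => [x0|_]; last first.
  rewrite normr0 mulr_ge0 ?sqr_ge0// (le_trans _ (Cb 0 (lexx _)))//.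
have xV0 : 0 <= x^-1 by rewrite invr_ge0 ltW.
rewrite normrM (ger0_norm (expR_ge0 _)) -ler_pdivrMr ?exprn_gt0//.
apply: le_trans (Cb _ xV0); rewrite hornerM hornerXn normrM normrX.
by rewrite (ger0_norm xV0) exprVn -[leRHS]mulrA [leRHS]mulrC.
Qed.

Definition flat_deriv p := 'X^2 * (p - p^`()%R).

Lemma is_derive_flat p x : is_derive x 1 (flat p) (flat (flat_deriv p) x).
Proof.
have [x0|x0|->] := ltgtP x 0.
- have -> : flat (flat_deriv p) x = 0 by rewrite /flat ltNge ltW.
  apply: (@near_eq_is_derive _ _ _ (cst 0)).
  near=> y; rewrite /flat ifF//; apply/negbTE; rewrite -leNgt ltW//.
  by near: y; exact: lt_nbhsl.
- pose h y := p.[y^-1] * expR (- y^-1).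
  apply: (@near_eq_is_derive _ _ _ h).
    near=> y; rewrite /flat ifT//; near: y; exact: lt_nbhsr.
  rewrite /flat x0 /flat_deriv.
  have dV : is_derive x 1 (fun y : R => y^-1) (- x ^- 2).
    have := @is_deriveV R id x 1 1; rewrite /= scaler1; by apply; rewrite gt_eqF.
  have d1 : is_derive x 1 (fun y : R => p.[y^-1]) (p^`().[x^-1] * - x ^- 2).
    exact: (@is_derive1_comp _ (horner p) _ _ _ _ (is_derive_poly p _) dV).
  have d2 : is_derive x 1 (fun y : R => expR (- y^-1)) (expR (- x^-1) * x ^- 2).
    have dN : is_derive x 1 (fun y : R => - y^-1) (x ^- 2).
      by rewrite -[X in is_derive _ _ _ X]opprK; exact: is_deriveN.
    exact: (@is_derive1_comp _ expR _ _ _ _ (is_derive_expR _) dN).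
  apply: (is_derive_eq (is_deriveM d1 d2)).
  rewrite !hornerE exprVn /GRing.scale/=; ring.
have -> : flat (flat_deriv p) 0 = 0 by rewrite /flat ltxx.
have [C Cb] := flat_quadratic p.
have f00 : flat p 0 = 0 by rewrite /flat ltxx.
have dq : (fun h : R => h^-1 *: ((flat p \o shift 0) (h *: 1) - flat p 0)) @ 0^' --> (0 : R).
  apply: (@cvg_to_0_linear _ _ C 1) => // h /andP[h0 _].
  rewrite /= addr0 scaler1 f00 subr0 /GRing.scale/= normrM normfV.
  rewrite ler_pdivrMl// (le_trans (Cb h))// -real_normK ?num_real//.
  by rewrite mulrCA.
apply: DeriveDef; first by apply/cvg_ex; exists 0.
by rewrite /derive; exact/cvg_lim.
Unshelve. all: by end_near. Qed.

Lemma flat1_ge0 x : 0 <= flat 1 x.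
Proof. by rewrite /flat; case: ifP => // _; rewrite hornerE mul1r expR_ge0. Qed.

Lemma flat1_gt0 x : 0 < x -> 0 < flat 1 x.
Proof. by rewrite /flat => ->; rewrite hornerE mul1r expR_gt0. Qed.

Lemma flat1_eq0 x : x <= 0 -> flat 1 x = 0.
Proof. by rewrite /flat leNgt => /negbTE ->. Qed.

Lemma flat1_le1 x : flat 1 x <= 1.
Proof.
rewrite /flat; case: ifP => // x0; rewrite hornerE mul1r -expR0 ler_expR oppr_le0.
by rewrite invr_ge0 ltW.
Qed.

Lemma flat1_le x y : x <= y -> flat 1 x <= flat 1 y.
Proof.
move=> xy; rewrite /flat; case: ifP => [x0|_]; last exact: flat1_ge0.
rewrite (lt_le_trans x0 xy) !hornerE ?mul1r ler_expR lerN2 lef_pV2 ?posrE//.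
exact: lt_le_trans xy.
Qed.

End flat.

Section smooth_alg.
Context {R : realType} (n : nat).

(** An algebra of functions that contains the bumps used below and is stable
    under partial derivatives; its members are therefore smooth. *)
Inductive smooth_alg : ('rV[R]_n -> R) -> Prop :=
| smooth_cst c : smooth_alg (fun=> c)
| smooth_flat_right p i c : smooth_alg (fun w => flat p (w 0 i - c))
| smooth_flat_left p i c : smooth_alg (fun w => flat p (c - w 0 i))
| smoothD f g : smooth_alg f -> smooth_alg g -> smooth_alg (fun w => f w + g w)
| smoothM f g : smooth_alg f -> smooth_alg g -> smooth_alg (fun w => f w * g w).

Lemma is_derive_coord (i j : 'I_n) (w : 'rV[R]_n) (h : R -> R) (dh : R) :
  is_derive (w 0 i) 1 h dh ->
  is_derive w (delta_mx 0 j) (fun w : 'rV[R]_n => h (w 0 i)) ((j == i)%:R * dh).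
Proof.
move=> dhE; have [->|ji] := eqVneq j i; rewrite ?mul1r ?mul0r.
  have E : (fun t : R => t^-1 *: (((fun w : 'rV[R]_n => h (w 0 i)) \o shift w)
      (t *: delta_mx 0 i) - h (w 0 i))) =
    (fun t => t^-1 *: ((h \o shift (w 0 i)) (t *: 1) - h (w 0 i))).
    by apply/funext => t /=; rewrite !mxE !eqxx mulr1 scaler1.
  have [dv dE] := dhE; apply: DeriveDef; first by rewrite /derivable E.
  by rewrite /derive E -dE.
have E : (fun t : R => t^-1 *: (((fun w : 'rV[R]_n => h (w 0 i)) \o shift w)
    (t *: delta_mx 0 j) - h (w 0 i))) = cst 0.
  apply/funext => t /=; rewrite !mxE eqxx/= eq_sym (negbTE ji) mulr0 add0r subrr.
  exact: scaler0.
apply: DeriveDef; first by rewrite /derivable E; exact: is_cvg_cst.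
by rewrite /derive E; exact: lim_cst.
Qed.

Lemma is_derive_smooth_alg f i : smooth_alg f ->
  exists2 f', smooth_alg f' & forall w, is_derive w (delta_mx 0 i) f (f' w).
Proof.
elim => [c|p j c|p j c|{}f g _ [f' sf' df] _ [g' sg' dg]|{}f g sf [f' sf' df] sg [g' sg' dg]].
- by exists (fun=> 0); [exact: smooth_cst|move=> w; exact: is_derive_cst].
- exists (fun w => (i == j)%:R * flat (flat_deriv p) (w 0 j - c)).
    by apply: smoothM; [exact: smooth_cst|exact: smooth_flat_right].
  move=> w; apply: (@is_derive_coord j i w (fun x => flat p (x - c))).
  have dB : is_derive (w 0 j) 1 (fun x : R => x - c) 1.
    by rewrite -[X in is_derive _ _ _ X]subr0; exact: is_deriveB.
  have := @is_derive1_comp _ (flat p) _ _ _ _ (is_derive_flat p _) dB.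
  by rewrite mulr1.
- exists (fun w => (i == j)%:R * (flat (flat_deriv p) (c - w 0 j) * -1)).
    apply: smoothM; first exact: smooth_cst.
    by apply: smoothM; [exact: smooth_flat_left|exact: smooth_cst].
  move=> w; apply: (@is_derive_coord j i w (fun x => flat p (c - x))).
  have dB : is_derive (w 0 j) 1 (fun x : R => c - x) (-1).
    by rewrite -[X in is_derive _ _ _ X]sub0r; exact: is_deriveB.
  exact: (@is_derive1_comp _ (flat p) _ _ _ _ (is_derive_flat p _) dB).
- exists (fun w => f' w + g' w); first exact: smoothD.
  by move=> w; exact: (is_deriveD (df w) (dg w)).
- exists (fun w => f w * g' w + g w * f' w).
    by apply: smoothD; exact: smoothM.
  by move=> w; exact: (is_deriveM (df w) (dg w)).
Qed.

Lemma continuous_flat p : continuous (flat p : R -> R).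
Proof.
move=> x; apply: differentiable_continuous; apply/derivable1_diffP.
exact: (ex_derive (is_derive := is_derive_flat p x)).
Qed.

Lemma continuous_smooth_alg f : smooth_alg f -> continuous f.
Proof.
elim => [c|p j c|p j c|{}f g _ cf _ cg|{}f g _ cf _ cg] w.
- exact: cst_continuous.
- apply: (@continuous_comp _ _ _ (fun w : 'rV[R]_n => w 0 j - c) (flat p)).
    by apply: continuousB; [exact: coord_continuous|exact: cst_continuous].
  exact: continuous_flat.
- apply: (@continuous_comp _ _ _ (fun w : 'rV[R]_n => c - w 0 j) (flat p)).
    by apply: continuousB; [exact: cst_continuous|exact: coord_continuous].
  exact: continuous_flat.
- by apply: continuousD; [exact: cf|exact: cg].
- by apply: continuousM; [exact: cf|exact: cg].
Qed.

Lemma smooth_algP f : smooth_alg f -> smooth f.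
Proof.
move=> sf s /=.
have sg : smooth_alg (foldr (@partial R n) f s).
  elim: s => //= i s IH; have [f' sf' df] := is_derive_smooth_alg i IH.
  suff -> : partial i (foldr (@partial R n) f s) = f' by [].
  by apply/funext => w; rewrite /partial; have [_ ->] := df w.
split; first exact: continuous_smooth_alg.
by move=> i w; have [g' _ dg] := is_derive_smooth_alg i sg; have [] := dg w.
Qed.

Lemma smooth_alg_prod (J : Type) (r : seq J) (F : J -> 'rV[R]_n -> R) :
  (forall j, smooth_alg (F j)) -> smooth_alg (fun w => \prod_(j <- r) F j w).
Proof.
move=> sF; elim: r => [|j r IH].
  by under eq_fun do rewrite big_nil; exact: smooth_cst.
by under eq_fun do rewrite big_cons; exact: smoothM.
Qed.

Lemma smooth_algX f k : smooth_alg f -> smooth_alg (fun w => f w ^+ k).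
Proof.
move=> sf; elim: k => [|k IH]; first exact: smooth_cst.
by under eq_fun do rewrite exprS; exact: smoothM.
Qed.

End smooth_alg.

Section cutoff.
Context {R : realType} (n : nat).
Variables p q : 'rV[R]_n.+1.

Implicit Types w : 'rV[R]_n.+1.

(** Shrinking the box by [e] on each side keeps the support of the bump inside
    the open box, as a test function requires. *)
Definition shrunk_bump (e : R) (w : 'rV[R]_n.+1) : R :=
  \prod_j (flat 1 (w 0 j - (p 0 j + e)) * flat 1 (q 0 j - e - w 0 j)).

Lemma shrunk_bump_ge0 e w : 0 <= shrunk_bump e w.
Proof. by apply: prodr_ge0 => j _; rewrite mulr_ge0 ?flat1_ge0. Qed.

Lemma shrunk_bump_le1 e w : shrunk_bump e w <= 1.
Proof.
apply: prodr_ile1 => j _; rewrite mulr_ge0 ?flat1_ge0//=.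
by rewrite mulr_ile1 ?flat1_ge0 ?flat1_le1.
Qed.

Lemma shrunk_bump_le e e' w : e <= e' -> shrunk_bump e' w <= shrunk_bump e w.
Proof.
move=> ee'; apply: ler_prod => j _; rewrite mulr_ge0 ?flat1_ge0//=.
by rewrite ler_pM ?flat1_ge0// flat1_le//; lra.
Qed.

Lemma shrunk_bump_gt0 e w : (forall j, p 0 j + e < w 0 j < q 0 j - e) ->
  0 < shrunk_bump e w.
Proof.
move=> h; apply: prodr_gt0 => j _; have /andP[h1 h2] := h j.
by rewrite mulr_gt0// flat1_gt0// subr_gt0.
Qed.

Lemma shrunk_bump_eq0 e w : ~ rect (fun j => `]p 0 j + e, q 0 j - e[%classic) w ->
  shrunk_bump e w = 0.
Proof.
move=> /existsNP[j]; rewrite /= in_itv/= => /negP; rewrite negb_and -!leNgt => h.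
rewrite /shrunk_bump (bigD1 j)//=; case/orP: h => h.
  by rewrite (@flat1_eq0 _ (w 0 j - _)) ?mul0r// subr_le0.
by rewrite (@flat1_eq0 _ (q 0 j - e - _)) ?mulr0 ?mul0r// subr_le0.
Qed.

(** A power of [1 - beta] tends to [0] where [beta > 0] and equals [1] elsewhere.
    The margin is taken to [0] together with the exponent to [oo]. *)
Definition cutoff (k : nat) (w : 'rV[R]_n.+1) : R :=
  1 - (1 - shrunk_bump k.+1%:R^-1 w) ^+ k.

Lemma smooth_cutoff k : smooth (cutoff k).
Proof.
apply: smooth_algP; rewrite /cutoff.
have sB (f g : 'rV[R]_n.+1 -> R) : smooth_alg f -> smooth_alg g ->
    smooth_alg (fun w => f w - g w).
  move=> sf sg; rewrite (_ : (fun w => _) = (fun w => f w + -1 * g w)).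
    by apply: smoothD => //; apply: smoothM => //; exact: smooth_cst.
  by apply/funext => w; rewrite mulN1r.
apply: (sB (fun=> 1)); first exact: smooth_cst.
apply: smooth_algX; apply: (sB (fun=> 1)); first exact: smooth_cst.
apply: smooth_alg_prod => j; apply: smoothM; first exact: smooth_flat_right.
exact: smooth_flat_left.
Qed.

Lemma cutoff_itv k w : 0 <= cutoff k w <= 1.
Proof.
have b0 := shrunk_bump_ge0 k.+1%:R^-1 w; have b1 := shrunk_bump_le1 k.+1%:R^-1 w.
have x0 : 0 <= 1 - shrunk_bump k.+1%:R^-1 w by rewrite subr_ge0.
rewrite /cutoff subr_ge0 exprn_ile1// ?gerBl//=.
exact: exprn_ge0.
Qed.

Lemma cutoff_support k : [set w | cutoff k w != 0] `<=`
  rect (fun j => `]p 0 j + k.+1%:R^-1, q 0 j - k.+1%:R^-1[%classic).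
Proof.
move=> w /= wk; apply: contrapT => h; move: wk.
by rewrite /cutoff shrunk_bump_eq0// subr0 expr1n subrr eqxx.
Qed.

Lemma test_function_cutoff (U : set 'rV[R]_n.+1) k :
  rect (fun j => `]p 0 j, q 0 j[%classic) `<=` U -> test_function U (cutoff k).
Proof.
move=> pqU; split; first exact: smooth_cutoff.
all: pose K := rect (fun j => `[p 0 j + k.+1%:R^-1, q 0 j - k.+1%:R^-1]%classic).
all: have cK : closed K by apply: closed_rect => j; exact: interval_closed.
all: have suppK : closure [set w | cutoff k w != 0] `<=` K.
all: try (rewrite [X in _ `<=` X](closure_id _).1//; apply: closure_subset;
  apply: (subset_trans (@cutoff_support k)) => w wk j; apply: subset_itv_oo_cc; exact: wk).
  apply: (@subclosed_compact _ _ K) => //; first exact: closed_closure.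
  by apply: rV_compact => j; exact: segment_compact.
apply: (subset_trans suppK); apply: subset_trans pqU => w wK j.
have := wK j; rewrite /= !in_itv/= => /andP[h1 h2].
by rewrite (lt_le_trans _ h1) ?ltrDl ?invr_gt0//= (le_lt_trans h2)// gtrBl invr_gt0.
Qed.

(** At a point of the box the bumps are bounded below by some [beta > 0] once the
    margin is small, since they increase when the margin decreases. *)
Lemma cutoff_cvg w :
  cutoff k w @[k --> \oo] --> (\1_(rect (fun j => `]p 0 j, q 0 j[%classic)) w : R).
Proof.
rewrite indicE; case: (boolP (_ \in _)) => [|]; rewrite ?inE => /= wpq; last first.
  rewrite (_ : (fun k => _) = cst 0); first exact: cvg_cst.
  apply/funext => k; rewrite /cutoff shrunk_bump_eq0 ?subr0 ?expr1n ?subrr// => h.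
  move/negP : wpq; apply; rewrite inE => j; have := h j; rewrite /= !in_itv/=.
  have : 0 < (k.+1%:R^-1 : R) by rewrite invr_gt0.
  by move: (k.+1%:R^-1 : R) => e e0 /andP[h1 h2]; apply/andP; split; lra.
have /choice[K KP] : forall j, exists K : nat,
    p 0 j + K.+1%:R^-1 < w 0 j < q 0 j - K.+1%:R^-1.
  move=> j; have := wpq j; rewrite /= in_itv/= => /andP[pw wq].
  pose m := Num.min (w 0 j - p 0 j) (q 0 j - w 0 j).
  have m0 : 0 < m by rewrite lt_min !subr_gt0 pw.
  have : (Num.truncn m^-1).+1%:R^-1 < m.
    by rewrite invf_plt ?posrE//; exact: truncnS_gt.
  rewrite lt_min => h; exists (Num.truncn m^-1).
  by move: (_^-1) h => e /andP[h1 h2]; apply/andP; split; lra.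
(* [M] is a small enough margin for all coordinates at once. *)
pose M := (\max_j K j)%N.
have b0 : 0 < shrunk_bump M.+1%:R^-1 w.
  apply: shrunk_bump_gt0 => j; have := KP j.
  have : (M.+1%:R^-1 : R) <= (K j).+1%:R^-1.
    by rewrite lef_pV2 ?posrE// ler_nat ltnS; exact: (leq_bigmax j).
  by move: (M.+1%:R^-1 : R) ((K j).+1%:R^-1 : R) => e e' ee' /andP[h1 h2]; apply/andP; split; lra.
set beta := shrunk_bump _ w in b0.
have beta1 : beta <= 1 by exact: shrunk_bump_le1.
have pow0 : (1 - shrunk_bump k.+1%:R^-1 w) ^+ k @[k --> \oo] --> (0 : R).
  apply: (@squeeze_cvgr _ _ _ _ (cst 0) (fun k => (1 - beta) ^+ k)).
  - exists M => // k /= Mk.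
    have bk : beta <= shrunk_bump k.+1%:R^-1 w.
      by apply: shrunk_bump_le; rewrite lef_pV2 ?posrE// ler_nat.
    have bk1 := shrunk_bump_le1 k.+1%:R^-1 w.
    rewrite exprn_ge0 ?subr_ge0//=.
    by apply: lerXn2r; rewrite ?nnegrE ?subr_ge0// lerD2l lerN2.
  - exact: cvg_cst.
  - by apply: cvg_expr; rewrite ger0_norm ?subr_ge0// gtrBl.
by rewrite -[X in _ --> X]subr0; apply: cvgB => //; exact: cvg_cst.
Qed.

End cutoff.

(** * Charges with a density *)

Section charge_density.
Context d (T : measurableType d) (R : realType).
Variable mu : {sigma_finite_measure set T -> \bar R}.
Local Open Scope ereal_scope.

(** The negative part of [r] integrates to minus the integral of [r] over
    [E `&` [set x | r x < 0]], hence to a nonpositive number. *)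
Lemma integral_abse_eq (r : T -> \bar R) E : measurable E -> mu.-integrable E r ->
  (forall A, measurable A -> A `<=` E -> 0 <= \int[mu]_(x in A) r x) ->
  \int[mu]_(x in E) `|r x| = \int[mu]_(x in E) r x.
Proof.
move=> mE ir r_ge0; have mr := measurable_int _ ir.
have rn0 : \int[mu]_(x in E) r^\- x = 0.
  pose A := E `&` [set x | r x < 0].
  have mA : measurable A by exact: emeasurable_fun_infty_o.
  apply/eqP; rewrite eq_le; apply/andP; split; last first.
    by apply: integral_ge0 => x _; exact: funeneg_ge0.
  have -> : \int[mu]_(x in E) r^\- x = \int[mu]_(x in A) - r x.
    rewrite integral_mkcond [RHS]integral_mkcond; apply: eq_integral => x _.
    rewrite !patchE funenegE; case: ifPn => xE.
      case: ifPn => [|xA].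
        by rewrite inE => -[_ /= rx]; apply/max_idPl; rewrite leeNr oppe0 ltW.
      apply/max_idPr; rewrite leeNl oppe0 leNgt; apply/negP => rx.
      by move/negP: xA; apply; rewrite inE; split => //; exact: set_mem.
    by rewrite ifN//; apply: contraNN xE; rewrite !inE => -[].
  have iA : mu.-integrable A r by apply: integrableS ir => //; exact: subIsetl.
  rewrite integralN; last exact: integrable_add_def.
  by rewrite leeNl oppe0; apply: r_ge0 => //; exact: subIsetl.
rewrite [RHS]integralE rn0 sube0.
transitivity (\int[mu]_(x in E) (r^\+ x + r^\- x)).
  by apply: eq_integral => x _; rewrite -[LHS]/((abse \o r) x) fune_abse.
rewrite ge0_integralD//; last 2 first.
- exact: measurable_funepos.
- exact: measurable_funeneg.
by rewrite rn0 adde0.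
Qed.

Section hahn.
Variables (nu : {charge set T -> \bar R}) (P N : set T).
Hypothesis nuPN : hahn_decomposition nu P N.

Let mP : measurable P. Proof. by case: nuPN => -[]. Qed.

Let mN : measurable N. Proof. by case: nuPN => _ []. Qed.

Lemma jordan_posE_setI A : measurable A -> jordan_pos nuPN A = nu (A `&` P).
Proof. by move=> mA; rewrite jordan_posE cjordan_posE /crestr0 mem_set. Qed.

Lemma jordan_negE_setI A : measurable A -> jordan_neg nuPN A = - nu (A `&` N).
Proof. by move=> mA; rewrite jordan_negE cjordan_negE /crestr0 mem_set. Qed.

(** The density is almost everywhere nonnegative on the positive set and
    nonpositive on the negative one. *)
Lemma charge_variation_density D (r : T -> \bar R) : measurable D ->
  mu.-integrable D r ->
  (forall A, measurable A -> A `<=` D -> nu A = \int[mu]_(x in A) r x) ->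
  charge_variation nuPN D = \int[mu]_(x in D) `|r x|.
Proof.
move=> mD ir nuE; have [[_ Ppos] [_ Nneg] PN PN0] := nuPN.
have mDP : measurable (D `&` P) by exact: measurableI.
have mDN : measurable (D `&` N) by exact: measurableI.
rewrite /charge_variation/= jordan_posE_setI// jordan_negE_setI//.
rewrite !nuE//.
have DE : D = (D `&` P) `|` (D `&` N) by rewrite -setIUr PN setIT.
have iDP : mu.-integrable (D `&` P) r by apply: integrableS ir => //; exact: subIsetl.
have iDN : mu.-integrable (D `&` N) r by apply: integrableS ir => //; exact: subIsetl.
rewrite [in RHS]DE ge0_integral_setU//; last 2 first.
- rewrite -DE; apply: measurableT_comp => //; exact: measurable_int ir.
- by apply/disj_setPS; rewrite setIACA PN0 setI0.
congr (_ + _).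
  rewrite integral_abse_eq// => A mA AD; rewrite -nuE//.
    by apply: Ppos => // x /AD[].
  by move=> x /AD[].
rewrite -integralN; last exact: integrable_add_def.
rewrite -(@integral_abse_eq (fun x => - r x))//.
- by apply: eq_integral => x _; rewrite abseN.
- by have := integrableN iDN.
- move=> A mA AD; rewrite integralN; last first.
    by apply: integrable_add_def => //; apply: integrableS iDN.
  rewrite -nuE//; last by move=> x /AD[].
  by rewrite leeNr oppe0; apply: Nneg => // x /AD[].
Qed.

End hahn.

(** The density [s] is almost everywhere the Radon-Nikodym derivative of [m]. *)
Lemma integral_finite_measure_density (m : {finite_measure set T -> \bar R})
    (s f : T -> \bar R) D : measurable D -> mu.-integrable setT s ->
  (forall A, measurable A -> m A = \int[mu]_(x in A) s x) ->
  m.-integrable D f ->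
  \int[m]_(x in D) f x = \int[mu]_(x in D) (f x * s x).
Proof.
move=> mD is_ mE if_.
have dom : m `<< mu.
  apply/null_content_dominatesP => A mA A0; rewrite mE//.
  have iA : mu.-integrable A s by exact: integrableS is_.
  by rewrite (negligible_integral mA mA iA A0) setDv integral_set0.
have mms : measurable_fun D s by apply: measurable_funTS; exact: measurable_int is_.
have dens : ae_eq mu D (Radon_Nikodym (charge_of_finite_measure m) mu) s.
  apply: integral_ae_eq => //.
  - by apply: (integrableS measurableT) => //; exact: Radon_Nikodym_integrable.
  - by move=> A _ mA; rewrite -Radon_Nikodym_integral//; exact: mE.
rewrite -(Radon_Nikodym_change_of_variables dom)//.
apply: ae_eq_integral => //.
- apply: emeasurable_funM; first exact: measurable_int if_.
  by apply: measurable_funTS; exact: measurable_int (Radon_Nikodym_integrable _).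
- by apply: emeasurable_funM => //; exact: measurable_int if_.
- exact: ae_eqe_mul2l.
Qed.

Lemma integrable_mul_bounded (m : {measure set T -> \bar R}) (h q : T -> R) D M :
  measurable D -> m.-integrable D (EFin \o h) -> measurable_fun D q ->
  (forall x, D x -> `|q x| <= M)%R -> m.-integrable D (fun x => (h x * q x)%:E).
Proof.
move=> mD ih mq qM; have mh : measurable_fun D h.
  by apply/measurable_EFinP; exact: measurable_int ih.
apply: (le_integrable mD _ _ (integrableZl mD M ih)).
  by apply/measurable_EFinP; exact: measurable_funM.
move=> x Dx; rewrite /= lee_fin !normrM mulrC ler_wpM2r//.
exact: le_trans (qM _ Dx) (ler_norm _).
Qed.

Lemma integrable_bounded (m : {finite_measure set T -> \bar R}) (q : T -> R) D M :
  measurable D -> measurable_fun D q ->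
  (forall x, D x -> `|q x| <= M)%R -> m.-integrable D (EFin \o q).
Proof.
move=> mD mq qM.
have i1 : m.-integrable D (EFin \o cst 1%R).
  by apply: finite_measure_integrable_cst.
have := integrable_mul_bounded mD i1 mq qM.
by apply: eq_integrable => // x _; rewrite /= mul1r.
Qed.

(** The Jordan components of [nu] have the densities [r \_ P] and [- (r \_ N)]. *)
Lemma Rintegral_jordan_density (nu : {charge set T -> \bar R}) P N
    (nuPN : hahn_decomposition nu P N) (r q : T -> R) D M :
  measurable D -> mu.-integrable setT (EFin \o r) ->
  (forall A, measurable A -> nu A = \int[mu]_(x in A) (r x)%:E) ->
  measurable_fun D q -> (forall x, D x -> `|q x| <= M)%R ->
  (\int[jordan_pos nuPN]_(x in D) q x - \int[jordan_neg nuPN]_(x in D) q x =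
   \int[mu]_(x in D) (r x * q x))%R.
Proof.
move=> mD ir nuE mq qM; have [[mP _] [mN _] PN PN0] := nuPN.
have ir_ (A : set T) : measurable A -> mu.-integrable setT (EFin \o (r \_ A)%R).
  move=> mA; rewrite -restrict_EFin; apply/(integrable_mkcond _ mA).
  exact: integrableS ir.
have iP := ir_ _ mP; have iN := ir_ _ mN.
have posE A : measurable A -> jordan_pos nuPN A = \int[mu]_(x in A) ((r \_ P) x)%:E.
  move=> mA; rewrite jordan_posE_setI// nuE; last exact: measurableI.
  rewrite integral_mkcondr; apply: eq_integral => x _.
  by rewrite !patchE; case: ifP.
have negE A : measurable A -> jordan_neg nuPN A = \int[mu]_(x in A) (- (r \_ N) x)%:E.
  move=> mA; rewrite jordan_negE_setI// nuE; last exact: measurableI.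
  rewrite integral_mkcondr -integralN; last first.
    by apply: integrable_add_def => //; have := integrableS measurableT mA (@subsetT _ _) iN;
      rewrite -restrict_EFin.
  by apply: eq_integral => x _; rewrite !patchE; case: ifP => // _; rewrite /= oppr0 oppe0.
have iNN : mu.-integrable setT (EFin \o (fun x => - (r \_ N) x)%R).
  by have := integrableN iN.
rewrite /Rintegral.
rewrite (integral_finite_measure_density mD iP posE (integrable_bounded _ mD mq qM)).
rewrite (integral_finite_measure_density mD iNN negE (integrable_bounded _ mD mq qM)).
have iqP : mu.-integrable D (fun x => ((r \_ P)%R x * q x)%:E).
  by apply: (integrable_mul_bounded mD _ mq qM); exact: integrableS iP.
have iqN : mu.-integrable D (fun x => ((- (r \_ N) x) * q x)%:E).
  apply: (integrable_mul_bounded mD (h := fun x => (- (r \_ N) x)%R) _ mq qM).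
  exact: integrableS iNN.
transitivity (\int[mu]_(x in D) ((r \_ P) x * q x) - \int[mu]_(x in D) ((- (r \_ N) x) * q x))%R.
  by rewrite /Rintegral; congr (fine _ - fine _)%R; apply: eq_integral => x _;
    rewrite -EFinM mulrC.
rewrite -RintegralB//; congr fine; apply: eq_integral => x _; congr EFin.
rewrite mulNr opprK -mulrDl; congr (_ * _)%R; rewrite !patchE.
have [xP|xP] := boolP (x \in P); last first.
  rewrite mem_set ?add0r//; have : (P `|` N) x by rewrite PN.
  by case=> // /mem_set xP'; rewrite xP' in xP.
rewrite memNset ?addr0// => xN; have : (P `&` N) x by split => //; exact: set_mem.
by rewrite PN0.
Qed.

(** The sets on which two charges agree are stable under complements and
    disjoint countable unions, so Dynkin's lemma applies. *)
Lemma charge_eq_dynkin (nu1 nu2 : {charge set T -> \bar R}) (G : set (set T)) D :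
  @measurable _ T = <<s G >> -> setI_closed G -> G D ->
  (forall A, G A -> nu1 (A `&` D) = nu2 (A `&` D)) ->
  forall A, measurable A -> nu1 (A `&` D) = nu2 (A `&` D).
Proof.
move=> GE GI GD nuE A mA.
have mD : measurable D by rewrite GE; exact: sub_sigma_algebra.
have nuD : nu1 D = nu2 D by have := nuE _ GD; rewrite setIid.
rewrite GE in mA; move: A mA.
apply: (dynkin_induction GE GI).
- by rewrite setTI.
- by move=> A GA; exact: nuE.
- move=> S mS SE.
  have compl (nu : {charge set T -> \bar R}) : nu (~` S `&` D) = nu D - nu (S `&` D).
    have mSD : measurable (S `&` D) by exact: measurableI.
    have mCD : measurable (~` S `&` D) by apply: measurableI => //; exact: measurableC.
    have -> : nu D = nu (~` S `&` D) + nu (S `&` D).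
      rewrite -chargeU//; last by rewrite setIACA setICl set0I.
      by rewrite -setIUl setUCl setTI.
    by rewrite -addeA subee ?adde0// fin_num_measure.
  by rewrite !compl nuD SE.
- move=> F mF tF FE.
  have sum (nu : {charge set T -> \bar R}) :
      (fun n => \sum_(0 <= i < n) nu (F i `&` D)) @ \oo --> nu (\bigcup_k F k `&` D).
    rewrite setI_bigcupl; apply: charge_semi_sigma_additive.
    - by move=> i; exact: measurableI.
    - exact: trivIset_setIr.
    - by apply: bigcup_measurable => k _; exact: measurableI.
  apply: (cvg_unique _ (sum nu1)) => //.
  have -> : (fun n => \sum_(0 <= i < n) nu1 (F i `&` D)) =
      (fun n => \sum_(0 <= i < n) nu2 (F i `&` D)).
    by apply/funext => n; apply: eq_bigr => i _; rewrite FE.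
  exact: sum.
Qed.

End charge_density.

(** * Integration by parts for tensor products *)

Section tensor.
Context {R : realType} (n : nat).
Variables a b : 'rV[R]_n.
Implicit Types k : 'I_n -> R -> R.

(** Extension by zero makes the integrals over the box integrals over the whole
    space, to which slicing applies; the boundary, a null set, is left out to
    have zero outside the interior. *)
Definition tensor k (w : 'rV[R]_n) : R := \prod_j (k j \_ `]a 0 j, b 0 j[%classic) (w 0 j).

Lemma tensorE k w : (box a b)° w -> tensor k w = \prod_j k j (w 0 j).
Proof.
rewrite interior_box => wab; apply: eq_bigr => j _.
by rewrite patchE mem_set//; exact: wab.
Qed.

Lemma tensor_out k w : ~ (box a b)° w -> tensor k w = 0.
Proof.
rewrite interior_box => /existsNP[j wj].
by rewrite /tensor (bigD1 j)//= patchE memNset// mul0r.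
Qed.

Lemma tensor_restrict k (q : 'rV[R]_n -> R) :
  (fun w => tensor k w * q w) \_ (box a b)° = (fun w => tensor k w * q w).
Proof.
apply/funext => w; rewrite patchE; case: ifPn => // /negP wab.
by rewrite tensor_out ?mul0r// => h; apply: wab; rewrite inE.
Qed.

Section continuous_factors.
Variable k : 'I_n -> R -> R.
Hypothesis ck : forall j, {within `[a 0 j, b 0 j], continuous (k j)}.

Lemma integrable_factor j :
  lebesgue_measure.-integrable setT (EFin \o (k j \_ `]a 0 j, b 0 j[%classic)).
Proof.
have moo : measurable (`]a 0 j, b 0 j[%classic : set (measurableTypeR R)).
  exact: measurable_itv.
rewrite -restrict_EFin; apply/(integrable_mkcond _ moo).
have := continuous_compact_integrable (@segment_compact _ (a 0 j) (b 0 j)) (@ck j).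
apply: integrableS => //; exact: subset_itv_oo_cc.
Qed.

Lemma measurable_tensor : measurable_fun setT (tensor k).
Proof.
apply: measurable_prod => j _; apply: (measurable_comp_coord (n := n)).
by apply/measurable_EFinP; exact: measurable_int (integrable_factor j).
Qed.

Lemma integral_abs_tensor : (\int[lebesgue_rV n]_w `|tensor k w|%:E =
  \prod_j \int[lebesgue_measure]_(t in `]a 0%R j, b 0%R j[) `|k j t|%:E)%E.
Proof.
transitivity (\int[lebesgue_rV n]_w
    \prod_j `|(k j \_ `]a 0%R j, b 0%R j[%classic) (w 0%R j)|%:E)%E.
  by apply: eq_integral => w _; rewrite /tensor normr_prod prod_EFin.
rewrite (integral_prod_coord
  (g := fun j t => `|(k j \_ `]a 0%R j, b 0%R j[%classic) t|%:E))//.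
  apply: eq_bigr => j _; rewrite [RHS]integral_mkcond; apply: eq_integral => t _.
  by rewrite !patchE; case: ifP => //; rewrite normr0.
move=> j; apply/measurable_EFinP; apply: measurableT_comp => //.
by apply/measurable_EFinP; exact: measurable_int (integrable_factor j).
Qed.

Lemma integrable_tensor : (lebesgue_rV n).-integrable setT (EFin \o tensor k).
Proof.
apply/integrableP; split.
  by apply/measurable_EFinP; exact: measurable_tensor.
rewrite -[X in (X < _)%E]/(\int[lebesgue_rV n]_w `|tensor k w|%:E)%E integral_abs_tensor.
suff /andP[] : (0 <= \prod_j \int[lebesgue_measure]_(t in `]a 0%R j, b 0%R j[)
    `|k j t|%:E < +oo)%E by [].
elim/big_ind : _ => [|x y /andP[x0 xoo] /andP[y0 yoo]|j _].
- by rewrite lee01 ltry.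
- by rewrite mule_ge0//= lte_mul_pinfty// ge0_fin_numE.
- rewrite integral_ge0//=; have /integrableP[_] := integrable_factor j.
  move=> h; rewrite integral_mkcond; apply: le_lt_trans h.
  rewrite le_eqVlt; apply/orP; left; apply/eqP; apply: eq_integral => t _.
  by rewrite /= !patchE; case: ifP => //; rewrite normr0.
Qed.

Lemma continuous_box_bounded (q : 'rV[R]_n -> R) : continuous q ->
  exists M : R, forall w, box a b w -> `|q w| <= M.
Proof.
move=> cq; have cS : compact (box a b).
  by rewrite boxE; apply: rV_compact => j; exact: segment_compact.
have : compact (q @` box a b).
  by apply: continuous_compact => //; exact: continuous_subspaceT.
move=> /compact_bounded[M [_ Mq]]; exists (M + 1) => w Sw.
by apply: (Mq (M + 1)); [rewrite ltrDl|exists w].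
Qed.

(** A continuous function is bounded on the box, outside of which the tensor
    product vanishes. *)
Lemma integrable_tensorM (q : 'rV[R]_n -> R) : continuous q ->
  (lebesgue_rV n).-integrable setT (fun w => (tensor k w * q w)%:E).
Proof.
move=> cq; have [M qM] := continuous_box_bounded cq.
have mtq : measurable_fun setT (fun w => (tensor k w * q w)%:E).
  apply/measurable_EFinP; apply: measurable_funM; first exact: measurable_tensor.
  exact: continuous_measurable_fun_rV.
apply: (le_integrable _ mtq _ (integrableZl measurableT M integrable_tensor)) => // w _.
rewrite /= lee_fin !normrM mulrC.
have [Sw|Sw] := pselect ((box a b)° w); last by rewrite tensor_out// normr0 !mulr0.
rewrite ler_wpM2r// (le_trans (qM _ _))//; first exact: interior_subset.
exact: ler_norm.
Qed.

End continuous_factors.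

End tensor.

Section line.
Context {R : realType} (n : nat).
Variables (i : 'I_n.+1) (v : 'rV[R]_n).

Lemma continuous_rV_ins : continuous (fun x : R => rV_ins i (x, v)).
Proof.
move=> x A [P xP PA]; have xPi : nbhs x (P 0 i) by have := xP 0 i; rewrite rV_insE.
apply: filterS xPi => y Py; apply: PA => l j; rewrite ord1.
case: (unliftP i j) => [k|] -> /=; last by rewrite rV_insE.
by have := nbhs_singleton (xP 0 (lift i k)); rewrite !rV_ins_lift.
Qed.

Lemma is_derive_line (psi : 'rV[R]_n.+1 -> R) x :
  derivable psi (rV_ins i (x, v)) (delta_mx 0 i) ->
  is_derive x 1 (fun t => psi (rV_ins i (t, v))) (partial i psi (rV_ins i (x, v))).
Proof.
move=> dpsi.
have E : (fun h : R => h^-1 *: (((fun t => psi (rV_ins i (t, v))) \o shift x) (h *: 1)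
    - psi (rV_ins i (x, v)))) =
  (fun h => h^-1 *: ((psi \o shift (rV_ins i (x, v))) (h *: delta_mx 0 i)
    - psi (rV_ins i (x, v)))).
  apply/funext => h /=; congr (_ *: (psi _ - _)).
  apply/rowP => j; rewrite scaler1 [RHS]mxE [X in _ = X + _]mxE [X in _ = _ * X + _]mxE.
  case: (unliftP i j) => [k|] ->; last by rewrite !rV_insE !eqxx mulr1.
  by rewrite !rV_ins_lift eqxx /= eq_sym (negbTE (neq_lift _ _)) mulr0 add0r.
apply: DeriveDef; first by rewrite /derivable E.
by rewrite /derive E.
Qed.

End line.

Section by_parts.
Context {R : realType} (n : nat).
Variables (a b : 'rV[R]_n.+1) (g : 'I_n.+1 -> R -> R) (i : 'I_n.+1).
Hypothesis ab : forall j, a 0 j < b 0 j.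
Hypothesis gC1 : forall j, Ck_on (side a b j) 1 (g j).

Definition partial_factor j : R -> R :=
  if j == i then derive_in (side a b i) (g i) else g j.

Lemma continuous_factor j : {within `[a 0 j, b 0 j], continuous (g j)}.
Proof. exact: (C1_continuous (gC1 j)). Qed.

Lemma continuous_partial_factor j :
  {within `[a 0 j, b 0 j], continuous (partial_factor j)}.
Proof.
rewrite /partial_factor; case: eqP => [->|_]; last exact: continuous_factor.
exact: (C1_continuous_derive (gC1 i)).
Qed.

Lemma tensor_ins k x v : tensor a b k (rV_ins i (x, v)) =
  (k i \_ `]a 0 i, b 0 i[%classic) x *
  \prod_(j < n) (k (lift i j) \_ `]a 0 (lift i j), b 0 (lift i j)[%classic) (v 0 j).
Proof.
rewrite /tensor (bigD1_ord i)//= rV_insE; congr (_ * _).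
by apply: eq_bigr => j _; rewrite rV_ins_lift.
Qed.

(** The factors of the other coordinates are constant on the line and can be
    absorbed in [psi]; the boundary terms vanish as [psi] is supported in the
    open box. *)
Lemma by_parts_line psi v : test_function (box a b)° psi ->
  (\int[lebesgue_measure]_x
      (tensor a b g (rV_ins i (x, v)) * partial i psi (rV_ins i (x, v)))%:E =
   \int[lebesgue_measure]_x
      (- (tensor a b partial_factor (rV_ins i (x, v)) * psi (rV_ins i (x, v))))%:E)%E.
Proof.
move=> [psi_smooth _ psi_supp].
pose c := \prod_(j < n)
  (g (lift i j) \_ `]a 0 (lift i j), b 0 (lift i j)[%classic) (v 0 j).
pose G (x : R) : R := c * psi (rV_ins i (x, v)).
pose dG (x : R) : R := c * partial i psi (rV_ins i (x, v)).
have [cpsi dpsi] := psi_smooth [::].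
have [cdpsi _] := psi_smooth [:: i].
have cG : continuous G.
  move=> x; apply: continuousM; first exact: cst_continuous.
  apply: (@continuous_comp _ _ _ (fun x : R => rV_ins i (x, v)) psi); last exact: cpsi.
  exact: continuous_rV_ins.
have cdG : continuous dG.
  move=> x; apply: cvgM; first exact: cvg_cst.
  apply: (@continuous_comp _ _ _ (fun x : R => rV_ins i (x, v)) (partial i psi)); last exact: cdpsi.
  exact: continuous_rV_ins.
have dGE (x : R) : is_derive x 1 G (dG x).
  by apply: is_deriveZ; apply: is_derive_line; exact: dpsi.
have psi0 w : ~ (box a b)° w -> psi w = 0.
  move=> nw; apply: contrapT => /eqP psiw; apply: nw; apply: psi_supp.
  exact: subset_closure.
have Gend (x : R) : x = a 0 i \/ x = b 0 i -> G x = 0.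
  move=> xab; rewrite /G psi0 ?mulr0// interior_box => /(_ i).
  by rewrite /= rV_insE in_itv/=; case: xab => ->; rewrite ltxx ?andbF.
have restr (h q : R -> R) :
    (\int[lebesgue_measure]_x (((h \_ `]a 0%R i, b 0%R i[) x * q x))%:E =
     \int[lebesgue_measure]_(x in `]a 0%R i, b 0%R i[) (h x * q x)%:E)%E.
  rewrite [RHS]integral_mkcond; apply: eq_integral => x _; rewrite !patchE.
  by case: ifP => //; rewrite mul0r.
have closed_itv (h q : R -> R) : {within `[a 0 i, b 0 i], continuous h} -> continuous q ->
    (\int[lebesgue_measure]_(x in `]a 0%R i, b 0%R i[) (h x * q x)%:E =
     \int[lebesgue_measure]_(x in `[a 0%R i, b 0%R i]) (h x * q x)%:E)%E.
  move=> ch cq.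
  have mhq : measurable_fun (`[a 0 i, b 0 i]%classic : set (measurableTypeR R))
      (fun x => (h x * q x)%:E).
    apply/measurable_EFinP; apply: measurable_funM.
      by apply: subspace_continuous_measurable_fun => //; exact: measurable_itv.
    by apply: measurable_funTS; exact: continuous_measurable_fun.
  exact: integral_itv_oo_cc.
transitivity (\int[lebesgue_measure]_x
    (((g i \_ `]a 0%R i, b 0%R i[) x * dG x))%:E)%E.
  by apply: eq_integral => x _; rewrite tensor_ins -mulrA.
rewrite restr closed_itv//; last exact: continuous_factor.
rewrite (integration_by_parts (ab i) (C1_continuous_derive (gC1 i))
  (C1_derivable_oo (ab i) (gC1 i)) (C1_derive1 (gC1 i)) _ (G := G)); last 3 first.
- exact: continuous_subspaceT.
- split => [x _||]; first by have := dGE x => ?; exact: ex_derive.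
    by apply: cvg_at_right_filter; exact: cG.
  by apply: cvg_at_left_filter; exact: cG.
- by move=> x _; rewrite derive1E; have := dGE x => ?; exact: derive_val.
rewrite (Gend (a 0 i)); last by left.
rewrite (Gend (b 0 i)); last by right.
rewrite !mulr0 subrr sub0e -integralN; last first.
  apply: integrable_add_def; first exact: measurable_itv.
  apply: continuous_compact_integrable; first exact: segment_compact.
  move=> x; apply: continuousM; first exact: (C1_continuous_derive (gC1 i)).
  exact: continuous_subspaceT.
under eq_integral do rewrite -EFinN -mulrN.
rewrite -closed_itv; last 2 first.
- exact: (C1_continuous_derive (gC1 i)).
- by move=> x; apply: continuousN; exact: cG.
rewrite -restr; apply: eq_integral => x _.
rewrite tensor_ins /partial_factor eqxx -mulrA mulrN.
congr (- (_ * (_ * _)))%:E.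
by apply: eq_bigr => j _; rewrite eq_sym (negbTE (neq_lift _ _)).
Qed.

Lemma by_parts psi : test_function (box a b)° psi ->
  (\int[lebesgue_rV n.+1]_w (tensor a b g w * partial i psi w)%:E =
   \int[lebesgue_rV n.+1]_w (- (tensor a b partial_factor w * psi w))%:E)%E.
Proof.
move=> tpsi; have [psi_smooth _ _] := tpsi.
have [cpsi _] := psi_smooth [::].
have [cdpsi _] := psi_smooth [:: i].
rewrite !(integral_lebesgue_rV_ins i).
- by apply: eq_integral => v _; exact: by_parts_line.
- have := integrableN (integrable_tensorM continuous_partial_factor cpsi).
  exact.
- exact: (integrable_tensorM continuous_factor cdpsi).
Qed.

End by_parts.

(** * Distributional derivative of a tensor product *)

Section variation.
Context {R : realType} (n : nat).
Variables (a b : 'rV[R]_n.+1) (g : 'I_n.+1 -> R -> R) (f : 'rV[R]_n.+1 -> R).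
Variable i : 'I_n.+1.
Hypothesis ab : forall j, a 0 j < b 0 j.
Hypothesis gC1 : forall j, Ck_on (side a b j) 1 (g j).
Hypothesis fE : forall w, box a b w -> f w = \prod_j g j (w 0 j).

Let mu := @lebesgue_rV R n.+1.
Let U := (box a b)°.
Let rho := tensor a b (partial_factor a b g i).

Let mU : measurable U.
Proof. by apply: open_measurable_rV; exact: open_interior. Qed.

Let irho : mu.-integrable setT (EFin \o rho).
Proof. by apply: integrable_tensor => j; exact: (continuous_partial_factor gC1). Qed.

Lemma eq_tensor_interior w : U w -> f w = tensor a b g w.
Proof. by move=> Uw; rewrite tensorE// fE//; exact: interior_subset Uw. Qed.

Lemma Rintegral_by_parts psi : test_function U psi ->
  \int[mu]_(w in U) (f w * partial i psi w) = - \int[mu]_(w in U) (rho w * psi w).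
Proof.
move=> tpsi; have [psi_smooth _ _] := tpsi.
have [cpsi _] := psi_smooth [::].
have toT k q : (\int[mu]_(w in U) (tensor a b k w * q w)%:E =
    \int[mu]_w (tensor a b k w * q w)%:E)%E.
  rewrite integral_mkcond; apply: eq_integral => w _.
  by rewrite restrict_EFin /= tensor_restrict.
rewrite /Rintegral toT (eq_integral (fun w => (tensor a b g w * partial i psi w)%:E)).
  rewrite toT (by_parts i ab gC1 tpsi).
  under eq_integral do rewrite EFinN.
  rewrite integralN ?fineN//; apply: integrable_add_def => //.
  by apply: integrable_tensorM => // j; exact: (continuous_partial_factor gC1).
by move=> w; rewrite inE => Uw; rewrite eq_tensor_interior.
Qed.

Lemma test_function_bounded psi : test_function U psi ->
  measurable_fun U psi /\ exists M : R, forall w, U w -> `|psi w| <= M.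
Proof.
move=> [psi_smooth _ _]; have [cpsi _] := psi_smooth [::].
split; first by apply: measurable_funTS; exact: continuous_measurable_fun_rV.
have [M psiM] := continuous_box_bounded a b cpsi.
by exists M => w /interior_subset; exact: psiM.
Qed.

Lemma integrable_on_compact K : compact K -> K `<=` U -> mu.-integrable K (EFin \o f).
Proof.
move=> cK KU; have mK : measurable K.
  rewrite -[K]setCK; apply: measurableC; apply: open_measurable_rV.
  by apply: closed_openC; apply: compact_closed => //; exact: norm_hausdorff.
have : mu.-integrable K (EFin \o tensor a b g).
  exact: integrableS (integrable_tensor (continuous_factor gC1)).
by apply: eq_integrable => // w; rewrite inE => /KU Uw; rewrite /= eq_tensor_interior.
Qed.

Lemma is_distr_derive_density (nu : {charge set 'rV[R]_n.+1 -> \bar R}) P N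
    (nuPN : hahn_decomposition nu P N) :
  (forall A, measurable A -> nu A = (\int[mu]_(w in A) (rho w)%:E)%E) ->
  is_distr_derive U i f nuPN.
Proof.
move=> nuE; split; first exact: integrable_on_compact.
move=> psi tpsi; rewrite Rintegral_by_parts//; congr (- _).
have [mpsi [M psiM]] := test_function_bounded tpsi.
by rewrite (Rintegral_jordan_density nuPN mU irho nuE mpsi psiM).
Qed.

(** Dominated convergence, with [|h|] as the dominating function. *)
Lemma cvg_integral_cutoff (m : {measure set 'rV[R]_n.+1 -> \bar R})
    (h : 'rV[R]_n.+1 -> R) (p q : 'rV[R]_n.+1) :
  let B := rect (fun j => `]p 0 j, q 0 j[%classic) in
  B `<=` U -> m.-integrable U (EFin \o h) ->
  \int[m]_(w in U) (h w * cutoff p q k w) @[k --> \oo] --> \int[m]_(w in B) h w.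
Proof.
move=> B BU ih.
have mB : measurable B by apply: measurable_rect => j; exact: measurable_itv.
have mh : measurable_fun U h by apply/measurable_EFinP; exact: measurable_int ih.
have mcut k : measurable_fun setT (cutoff p q k).
  apply: continuous_measurable_fun_rV; have [] := @smooth_cutoff _ _ p q k [::].
  by [].
have -> : \int[m]_(w in B) h w = \int[m]_(w in U) (h w * \1_B w).
  rewrite /Rintegral integral_mkcond [in RHS]integral_mkcond; congr fine.
  apply: eq_integral => w _; rewrite !patchE indicE.
  have [wB|wB] := boolP (w \in B); last by rewrite mulr0; case: ifP.
  by rewrite mem_set ?mulr1//; apply: BU; exact: set_mem.
apply: fine_cvg; rewrite fineK; last first.
  apply: integrable_fin_num => //; apply: (integrable_mul_bounded mU ih (M := 1)).
    by apply: measurable_funTS; exact: measurable_indic.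
  by move=> w _; rewrite indicE; case: (_ \in _); rewrite ?normr1 ?normr0.
apply: (@dominated_cvg _ _ _ m U mU _ _ (fun w => `|h w|%:E)).
- move=> k; apply/measurable_EFinP; apply: measurable_funM => //.
  exact: measurable_funTS.
- move=> w Uw; apply: cvg_EFin; first by apply: nearW.
  by apply: cvgM; [exact: cvg_cst|exact: cutoff_cvg].
- by [].
- by have := integrable_abse ih.
- move=> k w Uw; rewrite lee_fin normrM ler_piMr//.
  by have /andP[c0 c1] := cutoff_itv p q k w; rewrite ger0_norm.
Qed.

(** Testing against the cutoffs of an open box and passing to the limit gives
    the value of [nu] on that box; Dynkin's lemma does the rest. *)
Lemma density_of_distr_derive (nu : {charge set 'rV[R]_n.+1 -> \bar R}) P N
    (nuPN : hahn_decomposition nu P N) : is_distr_derive U i f nuPN ->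
  forall A, measurable A -> A `<=` U -> nu A = (\int[mu]_(w in A) (rho w)%:E)%E.
Proof.
move=> [_ nu_parts] A mA AU.
have -> : A = A `&` U by rewrite setIidl.
rewrite -[RHS]/(induced_charge irho (A `&` U)).
have GU : open_boxes U by exists a, b; rewrite /U interior_box.
apply: (@charge_eq_dynkin _ _ R nu _ (@open_boxes R n.+1)) => //.
- exact: measurable_rV_open_boxes.
- exact: setI_closed_open_boxes.
move=> B GB; have [p [q BUE]] := setI_closed_open_boxes GB GU.
have BU : rect (fun j => `]p 0 j, q 0 j[%classic) `<=` U.
  by rewrite -BUE; exact: subIsetr.
rewrite /induced_charge BUE.
have mB : measurable (rect (fun j => `]p 0 j, q 0 j[%classic)).
  by apply: measurable_rect => j; exact: measurable_itv.
have parts k : \int[jordan_pos nuPN]_(w in U) (1 * cutoff p q k w) -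
    \int[jordan_neg nuPN]_(w in U) (1 * cutoff p q k w) =
    \int[mu]_(w in U) (rho w * cutoff p q k w).
  have tk := test_function_cutoff k BU.
  have := nu_parts _ tk; rewrite Rintegral_by_parts// => /oppr_inj ->.
  by congr (_ - _); apply: eq_Rintegral => w _; rewrite mul1r.
have fin1 (m : {finite_measure set 'rV[R]_n.+1 -> \bar R}) :
    m.-integrable U (EFin \o (fun=> 1%R)).
  exact: finite_measure_integrable_cst.
have limL := cvgB (cvg_integral_cutoff BU (fin1 (jordan_pos nuPN)))
  (cvg_integral_cutoff BU (fin1 (jordan_neg nuPN))).
have irhoU : mu.-integrable U (EFin \o rho) by exact: integrableS irho.
have limR := cvg_integral_cutoff BU irhoU.
have E : (fun k => \int[jordan_pos nuPN]_(w in U) (1 * cutoff p q k w)) -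
    (fun k => \int[jordan_neg nuPN]_(w in U) (1 * cutoff p q k w)) =
    (fun k => \int[mu]_(w in U) (rho w * cutoff p q k w)).
  by apply/funext => k; rewrite -parts.
rewrite E in limL.
have {}limL := limL eventually_filter.
have := cvg_unique (@Rhausdorff R) limL limR.
set B' := rect _ in mB *.
have fin1B (m : {finite_measure set 'rV[R]_n.+1 -> \bar R}) :
    (\int[m]_(w in B') 1)%:E = m B'.
  by rewrite Rintegral_cst// mul1r fineK// fin_num_measure.
have finrho : ((\int[mu]_(w in B') rho w)%:E = \int[mu]_(w in B') (rho w)%:E)%E.
  by rewrite fineK//; apply: integrable_fin_num => //; exact: integrableS irho.
move=> /(_ (fmap_proper_filter _ eventually_filter)) /(congr1 (@EFin R)).
rewrite EFinB fin1B fin1B finrho => h; apply: (eq_trans _ h).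
by rewrite (jordan_decomp nuPN mB) /cadd/= cscaleN1.
Qed.

Lemma integral_abs_partial_tensor : (forall j, prob_density (side a b j) (g j)) ->
  (\int[mu]_(w in U) `|(rho w)%:E| =
   \int[lebesgue_measure]_(t in side a b i) `|derive_in (side a b i) (g i) t|%:E)%E.
Proof.
move=> dens; transitivity (\int[mu]_w `|rho w|%:E)%E.
  rewrite integral_mkcond; apply: eq_integral => w _; rewrite patchE.
  by case: ifPn => // /negP nU; rewrite /rho tensor_out ?normr0// => Uw; apply: nU; rewrite inE.
rewrite integral_abs_tensor; last by move=> j; exact: (continuous_partial_factor gC1).
have closed j : (\int[lebesgue_measure]_(t in `]a 0%R j, b 0%R j[)
      `|partial_factor a b g i j t|%:E =
    \int[lebesgue_measure]_(t in side a b j) `|partial_factor a b g i j t|%:E)%E.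
  apply: integral_itv_oo_cc; apply/measurable_EFinP; apply: measurableT_comp => //.
  apply: subspace_continuous_measurable_fun; first exact: measurable_itv.
  exact: (continuous_partial_factor gC1).
rewrite (bigD1 i)//= closed big1 ?mule1.
  by apply: eq_integral => t _; rewrite /partial_factor eqxx.
move=> j /negbTE ji; have [g0 <-] := dens j; rewrite closed.
apply: eq_integral => t; rewrite inE => It.
by rewrite /partial_factor ji ger0_norm//; exact: g0.
Qed.

(** The charge with density [rho] represents the derivative, and every charge
    that does has density [rho] on the interior, hence the same variation. *)
Lemma distr_variation_prod : (forall j, prob_density (side a b j) (g j)) ->
  (distr_variation (box a b) i f =
   \int[lebesgue_measure]_(t in side a b i) `|derive_in (side a b i) (g i) t|%:E)%E.
Proof.
move=> dens; rewrite -integral_abs_partial_tensor//.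
have irhoU : mu.-integrable U (EFin \o rho) by exact: integrableS irho.
have varE (nu : {charge set 'rV[R]_n.+1 -> \bar R}) P N
    (nuPN : hahn_decomposition nu P N) : is_distr_derive U i f nuPN ->
    charge_variation nuPN U = (\int[mu]_(w in U) `|(rho w)%:E|)%E.
  by move=> nuD; apply: charge_variation_density => //; exact: density_of_distr_derive nuD.
rewrite /distr_variation; apply: xget_subset1 => /=.
  pose nu : {charge set 'rV[R]_n.+1 -> \bar R} := induced_charge irho.
  have [P [N nuPN]] := Hahn_decomposition nu.
  have nuD : is_distr_derive U i f nuPN by exact: is_distr_derive_density.
  by exists nu, P, N, nuPN; split => //; rewrite varE.
move=> x y [nu [P [N [nuPN [nuD ->]]]]] [nu' [P' [N' [nuPN' [nuD' ->]]]]].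
by rewrite !varE.
Qed.

End variation.

(** * Tensor products of functions on the sides of a box *)

Lemma Ck_on_C1 (R : realType) (A : set R) k (g : R -> R) : Ck_on A k.+1 g -> Ck_on A 1 g.
Proof.
by move=> [cg [dg cdg]]; split => //; split => //; split => //; case: k cdg => [|k] [].
Qed.

Theorem proposition2p19 (R : realType) (d : nat) (a b : 'rV[R]_d)
    (I : {set 'I_d}) (hd : (1 <= d)%N) (hab : forall j, a 0 j < b 0 j)
    (hI : I != finset.set0) :
  let S := box a b in
  let mu := lebesgue_rV d in
  (forall (h : 'I_d -> R -> R) (phi : 'rV[R]_d -> R),
    (forall j, Linfty_on lebesgue_measure (side a b j) (h j)) ->
    measurable_fun S phi ->
    {ae mu, forall w, S w -> phi w = \prod_j h j (w 0 j)} ->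
    {ae mu, forall w, S w -> P_op a b I phi w =
      (\prod_(i in I) (h i (w 0 i) - mean a b i (h i))) *
      (\prod_(j in ~: I) h j (w 0 j))} /\
    ((forall i, i \in I -> mean a b i (h i) = 0) ->
      {ae mu, forall w, S w -> P_op a b I phi w = phi w}))
  /\
  (forall (fs : 'I_d -> R -> R) (f : 'rV[R]_d -> R),
    (forall j, Ck_on (side a b j) d (fs j)) ->
    (forall j, prob_density (side a b j) (fs j)) ->
    (forall w, S w -> f w = \prod_j fs j (w 0 j)) ->
    let L i := (\int[lebesgue_measure]_(t in side a b i)
                  `|derive_in (side a b i) (fs i) t|%:E)%E in
    [/\ TV I f S = (\sum_(i in I) L i)%E,
        (\int[mu]_(w in S) `|partials_in a b I f w|%:E = \prod_(i in I) L i)%E &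
        vitali_variation f S = (\prod_(i < d) L i)%E]).
Proof.
case: d a b I hd hab hI => [//|n] a b I _ hab hI S mu; split.
  move=> h phi hh mphi phiE.
  have ih i : i \in I -> lebesgue_measure.-integrable (side a b i) (EFin \o h i).
    by move=> _; exact: Linfty_integrable.
  have PE := P_op_prod ih phiE; split; first exact: PE.
  move=> mean0; apply: filterS2 PE phiE => w PE phiE Sw; rewrite PE// phiE//.
  rewrite [RHS](bigID (mem I))/=; congr (_ * _).
    by apply: eq_bigr => i iI; rewrite mean0// subr0.
  by apply: eq_bigl => j; rewrite finset.in_setC.
move=> fs f fsC dens fE L.
have fsC1 j : Ck_on (side a b j) 1 (fs j) by exact: Ck_on_C1 (fsC j).
split.
- by apply: eq_bigr => i _; exact: distr_variation_prod.
- exact: integral_partials_in.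
- exact: vitali_variation_prod.
Qed.
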